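(* Let $X,Y\subset\mathbb R^d$ be closed, $\Omega=X\times Y$, and let $\mu$ and $\nu$ be Borel probability measures on $X$ and $Y$, respectively. Then for every $\xi\in\mathcal B_b(\Omega)$, $$\begin{aligned}\sup_{\eta\in\mathcal Q_{ot}}\eta(\xi)&=\mathbf D\big(\xi;\hat{\mathcal H}_{ot}^\infty+\mathcal B_b(\Omega)_-\big)\\&=\min\{c\in\mathbb R:\ \exists\,\zeta\in\mathcal Z_{ot},\ h\oplus g\in\mathcal H_{ot}^\infty\text{ such that }c\,\mathbf 1+\zeta+h\oplus g\ge\xi\}.\end{aligned}$$
   Context: $\mathcal B_b(Z)$ is the space of bounded real-valued Borel measurable functions on $Z$ with pointwise order, and $\mathcal B_b(\Omega)_-$ its non-positive elements. $(h\oplus g)(x,y)=h(x)+g(y)$; $\mathbf 1$ is the constant function $1$. Let $\mathcal H_{ot}=\{h\oplus g:h\in C_b(X),\ g\in C_b(Y),\ \mu(h)=\nu(g)=0\}$ and $\mathcal Q_{ot}=\{\eta\in (C_b(\Omega)')_+:\eta(\mathbf 1)=1,\ \eta(f)=0\ \forall f\in\mathcal H_{ot}\}$. Elements of $\mathcal Q_{ot}$ are identified with the countably additive Borel probability measures on $\Omega$ whose marginals are $\mu$ and $\nu$; $\eta(\xi)=\int_\Omega\xi\,d\eta$. A Borel set $N\subset\Omega$ is $\mathcal Q_{ot}$-polar if $\eta(N)=0$ for every $\eta\in\mathcal Q_{ot}$. $\mathcal Z_{ot}$ is the set of $\zeta\in\mathcal B_b(\Omega)$ such that $\{\zeta\ne0\}$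 is $\mathcal Q_{ot}$-polar. $\mathcal H_{ot}^\infty=\{h\oplus g:h\in\mathcal B_b(X),\ g\in\mathcal B_b(Y),\ \mu(h)=\nu(g)=0\}$ and $\hat{\mathcal H}_{ot}^\infty=\{\zeta+h\oplus g:\zeta\in\mathcal Z_{ot},\ h\oplus g\in\mathcal H_{ot}^\infty\}$. For $\mathcal K\subset\mathcal B_b(\Omega)$: $\mathbf D(\xi;\mathcal K)=\inf\{c\in\mathbb R:\exists\,k\in\mathcal K\text{ with }c\,\mathbf 1+k=\xi\}$. *)

(* Defs.v *)
From HB Require Import structures.
From mathcomp Require Import all_boot all_order all_algebra.
From mathcomp Require Import all_classical all_reals all_analysis.

Set Implicit Arguments.
Unset Strict Implicit.
Unset Printing Implicit Defensive.

Import Order.TTheory GRing.Theory Num.Theory.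
Import numFieldNormedType.Exports.
Local Open Scope classical_set_scope.
Local Open Scope ring_scope.

(* [set_type A] with its subspace topology; MathComp-Analysis requires the
   carrier of a sigma-algebra to be pointed, hence the proof of nonemptiness
   as a parameter.  The chosen point plays no role. *)
Definition pointed_sub (E : topologicalType) (A : set E) (A0 : A !=set0)
  : Type := A.

HB.instance Definition _ (E : topologicalType) (A : set E) (A0 : A !=set0) :=
  Topological.copy (pointed_sub A0) (set_type A).
HB.instance Definition _ (E : topologicalType) (A : set E) (A0 : A !=set0) :=
  isPointed.Build (pointed_sub A0) (SigSub (mem_set (projT2 (cid A0)))).

HB.instance Definition _ (X Y : ptopologicalType) := Pointed.on (X * Y)%type.

Definition borel (Z : ptopologicalType) := g_sigma_algebraType (@open Z).

Section function_spaces.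
Context (R : realType) (Z : ptopologicalType).

Definition Cb : set (Z -> R) := [set f | continuous f /\ bounded_fun f].

Definition Bb : set (Z -> R) :=
  [set f | measurable_fun [set: borel Z] (f : borel Z -> R) /\ bounded_fun f].

Definition Bb_nonpos : set (Z -> R) := [set f | Bb f /\ forall z, f z <= 0].

Definition supnorm (f : Z -> R) : R := sup (range (fun z => `|f z|)).

(* Only the restriction to [Cb] of a functional [eta : (Z -> R) -> R] is
   meaningful: all conditions below are about its values on [Cb]. *)
Definition Cb_dual : set ((Z -> R) -> R) := [set eta |
  (forall (a : R) f g, Cb f -> Cb g ->
     eta (fun z => a * f z + g z) = a * eta f + eta g) /\
  (exists C : R, forall f, Cb f -> `|eta f| <= C * supnorm f)].

Definition Cb_dual_pos : set ((Z -> R) -> R) := [set eta |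
  Cb_dual eta /\ forall f, Cb f -> (forall z, 0 <= f z) -> 0 <= eta f].

(* The infimum is taken in the extended reals, so that it is [+oo] when no
   [c] is admissible. *)
Definition dual_value (xi : Z -> R) (K : set (Z -> R)) : \bar R :=
  ereal_inf [set c%:E | c in
    [set c : R | exists2 k, K k & (fun z => c + k z) = xi]].

End function_spaces.

Arguments Cb {R Z}.
Arguments Bb {R Z}.
Arguments Bb_nonpos {R Z}.
Arguments Cb_dual {R Z}.
Arguments Cb_dual_pos {R Z}.

Definition set_add (R : realType) (Z : Type) (K L : set (Z -> R)) :
  set (Z -> R) := [set f \+ g | f in K & g in L].

Definition is_minimum (R : realType) (S : set R) (c : R) : Prop :=
  S c /\ lbound S c.

Section optimal_transport.
Context (R : realType) (X Y : ptopologicalType).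
Context (mu : probability (borel X) R) (nu : probability (borel Y) R).

Let Omega : ptopologicalType := (X * Y)%type.

Definition oplus (h : X -> R) (g : Y -> R) : Omega -> R :=
  fun w => h w.1 + g w.2.

Definition centered (h : X -> R) (g : Y -> R) : Prop :=
  (\int[mu]_x (h x)%:E = 0 /\ \int[nu]_y (g y)%:E = 0)%E.

Definition Hot : set (Omega -> R) := [set f | exists h g,
  [/\ Cb h, Cb g, centered h g & f = oplus h g]].

Definition Qot : set ((Omega -> R) -> R) := [set eta |
  [/\ Cb_dual_pos eta, eta (cst 1) = 1 & forall f, Hot f -> eta f = 0]].

(* The identification of an element of [Qot] with a Borel probability measure
   having marginals [mu] and [nu]. *)
Definition identified (eta : (Omega -> R) -> R)
    (m : probability (borel Omega) R) : Prop :=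
  [/\ forall A : set (borel X), measurable A -> m (A `*` [set: Y]) = mu A,
      forall B : set (borel Y), measurable B -> m ([set: X] `*` B) = nu B
    & forall f, Cb f -> (eta f)%:E = (\int[m]_w (f w)%:E)%E].

Definition Qot_measures : set (probability (borel Omega) R) :=
  [set m | exists2 eta, Qot eta & identified eta m].

Definition polar (N : set (borel Omega)) : Prop :=
  measurable N /\ forall m, Qot_measures m -> m N = 0%E.

Definition Zot : set (Omega -> R) :=
  [set zeta | Bb zeta /\ polar [set w | zeta w != 0]].

Definition Hot_infty : set (Omega -> R) := [set f | exists h g,
  [/\ Bb h, Bb g, centered h g & f = oplus h g]].

Definition Hot_infty_hat : set (Omega -> R) := set_add Zot Hot_infty.

Definition primal_value (xi : Omega -> R) : \bar R :=
  ereal_sup [set (\int[m]_w (xi w)%:E)%E | m in Qot_measures].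

Definition superhedging_levels (xi : Omega -> R) : set R :=
  [set c | exists zeta f, [/\ Zot zeta, Hot_infty f
    & forall w, xi w <= c + zeta w + f w]].

End optimal_transport.

(* Main.v *)
From HB Require Import structures.
Require Import Defs.
From mathcomp Require Import all_boot all_order all_algebra.
From mathcomp Require Import all_classical all_reals all_analysis.
From mathcomp Require Import measurable_realfun.
From mathcomp Require Import ring lra.
Import Order.TTheory GRing.Theory Num.Theory.
Import numFieldNormedType.Exports.

(** Weak duality is integration of a superhedging inequality against a coupling.
For the converse it is enough to treat a payoff xi with values in [0, 1], and
to show that if xi cannot be dominated by a sum h(x) + g(y) of cost
mu(h) + nu(g) at most c, then some coupling m has m(xi) > c.

Dominating pairs may be truncated to [0, 1].  A decreasing sequence of nonempty
convex sets of such pairs contains almost minimizers of the L2 energy, which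
form a Cauchy sequence by the parallelogram identity; the pointwise upper limit
of a fast subsequence dominates everything that the sets have to dominate, and
its cost is at most the limit of the costs ([hedges_limit]).  This has two
consequences: the minimal cost is attained, and it is continuous along
increasing sequences of hypographs.  By the first one, c can be raised a little
before xi is approximated; by the second one, having no dominating pair of cost at
most c is a capacity-like property of hypographs, seen as subsets of X * Y * R.

The hypograph of a Borel payoff is obtained by Suslin's operation from the
hypographs of functions that are simple over measurable rectangles, and
Choquet's argument ([capacitability]) replaces xi by a decreasing sequence f_k
of such functions, with infimum below xi, none of which has a dominating pair of
cost at most c.

For such a sequence, the functions bounded below by a multiple of some f_k - c,
up to a sum of nonpositive cost, form a proper convex cone.  Extending it to a
half space ([cone_functional]) gives a positive functional eta on bounded
functions with eta(h + g) = mu(h) + nu(g) and eta(f_k) >= c.  On rectangles eta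
is a finitely additive set function whose marginals are regular with respect to
compact sets, hence it is countably additive there and extends to a Borel
coupling ([coupling_extension]).  That coupling integrates the f_k as eta does,
and monotone convergence gives m(xi) >= c. *)

Set Implicit Arguments.
Unset Strict Implicit.
Unset Printing Implicit Defensive.

Local Open Scope classical_set_scope.
Local Open Scope ring_scope.

(** * Suslin's operation and Choquet's capacitability theorem *)

Section prefix_recursion.

Definition agree (n : nat) (s t : nat -> nat) := forall i, (i < n)%N -> s i = t i.

Definition upd (s : nat -> nat) (l j : nat) : nat -> nat :=
  fun i => if i == l then j else s i.

(** Dependent choice along an infinite branch: each step may only change the
value at the next index, so the successive approximations stabilize. *)
Lemma prefix_recursion (Q : nat -> (nat -> nat) -> Prop) (s0 : nat -> nat) :
  (forall l s t, agree l s t -> Q l s -> Q l t) ->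
  Q 0%N s0 ->
  (forall l s, Q l s -> exists j, Q l.+1 (upd s l j)) ->
  exists s, forall l, Q l s.
Proof.
move=> Qagree Q0 Qstep.
have [j jP] : exists j : nat -> (nat -> nat) -> nat,
    forall l s, Q l s -> Q l.+1 (upd s l (j l s)).
  have /choice[j jP] : forall ls : nat * (nat -> nat), exists j,
      Q ls.1 ls.2 -> Q ls.1.+1 (upd ls.2 ls.1 j).
    move=> [l s] /=; have [Qls|nQ] := pselect (Q l s).
      by have [j Qj] := Qstep _ _ Qls; exists j.
    by exists 0%N.
  by exists (fun l s => j (l, s)) => l s; exact: (jP (l, s)).
pose fix S l := if l is l'.+1 then upd (S l') l' (j l' (S l')) else s0.
have QS l : Q l (S l) by elim: l => //= l /jP.
have Sst l k i : (i < l)%N -> S (l + k)%N i = S l i.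
  move=> il; elim: k => [|k IH]; first by rewrite addn0.
  by rewrite addnS /= /upd ifF // ltn_eqF // (leq_trans il) // leq_addr.
exists (fun i => S i.+1 i) => l; apply: Qagree (QS l) => i il.
by rewrite -(subnKC il) Sst.
Qed.

End prefix_recursion.

Section suslin.
Variables (T : Type) (P : set (set T)).

(** The usual Suslin operation indexes the sets by finite sequences; here a set
indexed by a prefix of length n is a function of the whole branch that
depends on its first n terms only, which spares all coding of sequences. *)
Definition suslin (A : set T) := exists F : nat -> (nat -> nat) -> set T,
  [/\ forall n s, P (F n s),
      forall n s t, agree n s t -> F n s = F n t &
      A = [set x | exists s, forall n, F n s x]].

Lemma suslin_base A : P A -> suslin A.
Proof.
move=> PA; exists (fun _ _ => A); split=> //.
apply/seteqP; split=> [x Ax|x [s /(_ 0%N)//]].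
by exists id.
Qed.

Hypothesis P0 : P set0.
Hypothesis PT : P setT.
Hypothesis PU : forall A B, P A -> P B -> P (A `|` B).
Hypothesis PI : forall A B, P A -> P B -> P (A `&` B).

(** The first term of a branch selects one of the countably many schemes, and
the rest of the branch runs it.  The depth shift leaves one free level, which
is filled with the full set. *)
Lemma suslin_bigcup (A : nat -> set T) :
  (forall k, suslin (A k)) -> suslin (\bigcup_k A k).
Proof.
move=> /choice[F FP].
exists (fun n s => if n is n'.+1 then F (s 0%N) n' (fun i => s i.+1) else setT).
split.
- by case=> [|n] s //; have [] := FP (s 0%N).
- case=> [|n] s t st //; rewrite -(st 0%N)//.
  have [_ Fl _] := FP (s 0%N); apply: Fl => i il; exact: st.
- apply/seteqP; split=> x.
    move=> [k _]; have [_ _ ->] := FP k => -[s sP].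
    by exists (fun i => if i is i'.+1 then s i' else k); case.
  move=> [s sP]; exists (s 0%N) => //; have [_ _ ->] := FP (s 0%N).
  by exists (fun i => s i.+1) => n; exact: (sP n.+1).
Qed.

(** A pairing of indices which is increasing in its second argument: the first
n terms of the k-th branch are then read off before position [pair k n]. *)
Let pair k n := (2 ^ k * n.*2.+1)%N.

Let pair_dec m : (0 < m)%N -> m = pair (logn 2 m) ((m %/ 2 ^ logn 2 m)./2).
Proof.
move=> m0; rewrite /pair.
have /dvdnP[q mq] := pfactor_dvdnn 2 m.
have q_odd : odd q.
  have q0 : (0 < q)%N by move: m0; rewrite mq muln_gt0 => /andP[].
  have : logn 2 m = (logn 2 q + logn 2 m)%N.
    by rewrite {1}mq lognM ?expn_gt0// pfactorK.
  move/esym/eqP; rewrite -{2}(add0n (logn 2 m)) eqn_add2r => /eqP lq.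
  by move: (lognE 2 q); rewrite lq q0/= dvdn2; case: (odd q).
have -> : (m %/ 2 ^ logn 2 m)%N = q by rewrite [X in (X %/ _)%N]mq mulnK ?expn_gt0.
rewrite [LHS]mq mulnC; congr (_ * _)%N.
by rewrite -add1n -[1%N]/(nat_of_bool true) -q_odd odd_double_half.
Qed.

Let logn_pair k n : logn 2 (pair k n) = k.
Proof.
rewrite /pair lognM ?expn_gt0// pfactorK// [X in (_ + X)%N]lognE /= dvdn2 /=.
by rewrite odd_double /= addn0.
Qed.

Let pairK k n : (pair k n %/ 2 ^ k)./2 = n.
Proof. by rewrite /pair mulKn ?expn_gt0// /= uphalf_double. Qed.

(** A single branch codes one branch for each of the schemes, through the
pairing; level [pair k n] tests level n of the k-th scheme. *)
Lemma suslin_bigcap (A : nat -> set T) :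
  (forall k, suslin (A k)) -> suslin (\bigcap_k A k).
Proof.
move=> /choice[F FP].
pose K m := logn 2 m; pose N m := (m %/ 2 ^ K m)./2.
exists (fun m s => F (K m) (N m) (fun i => s (pair (K m) i))); split.
- by move=> m s; have [] := FP (K m).
- move=> m s t st; have [_ Fl _] := FP (K m); apply: Fl => i iN; apply: st.
  have m0 : (0 < m)%N by case: (posnP m) iN => // ->; rewrite /N div0n.
  by rewrite [X in (_ < X)%N](pair_dec m0) ltn_pmul2l ?expn_gt0// ltnS ltn_double.
- apply/seteqP; split=> x.
    move=> Ax.
    have /choice[s sP] : forall k, exists s, forall n, F k n s x.
      by move=> k; have := Ax k I; have [_ _ ->] := FP k.
    exists (fun m => s (K m) (N m)) => m.
    have := sP (K m) (N m); have [_ Fl _] := FP (K m).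
    rewrite (Fl (N m) _ (s (K m)))// => i _.
    by rewrite /N /K logn_pair pairK.
  move=> [s sP] k _; have [_ _ ->] := FP k.
  exists (fun i => s (pair k i)) => n.
  by have := sP (pair k n); rewrite /N /K logn_pair pairK.
Qed.

Section capacitability.
Variable C : set (set T).
Hypothesis C_up : forall A B, A `<=` B -> C A -> C B.
Hypothesis C_cont : forall A : nat -> set T,
  (forall n, A n `<=` A n.+1) -> C (\bigcup_n A n) -> exists n, C (A n).

(** Choquet's argument, for a property C that is only upward closed and
inherited by some term of every increasing sequence whose union has it (a
capacitance in the sense of Dellacherie).  Continuity of C bounds the terms of
the branches one after the other without leaving C; the branches below these
bounds form a compact set, so by Koenig's lemma their finite approximations
B k, which are finite unions of finite intersections, decrease into A. *)
Theorem capacitability A : suslin A -> C A ->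
  exists B : nat -> set T,
    [/\ forall k, P (B k), forall k, C (B k), forall k, B k.+1 `<=` B k &
        \bigcap_k B k `<=` A].
Proof.
move=> [F [PF Fl AE]] CA.
pose below k m (s : nat -> nat) := forall i, (i < k)%N -> (s i <= m i)%N.
pose Am m k := [set x | exists2 s, below k m s & forall n, F n s x].
(* the bounds m on the terms of the branches, found one index at a time *)
have [m mP] : exists m, forall k, C (Am m k).
  apply: (@prefix_recursion (fun k m => C (Am m k)) id).
  - move=> l s t st; apply: C_up => x [u us xu]; exists u => // i il.
    by rewrite -st// us.
  - by apply: C_up CA; rewrite AE => x [s sP]; exists s.
  - move=> l m; pose Aj j := Am (upd m l j) l.+1.
    rewrite (_ : Am m l = \bigcup_j Aj j); last first.
      apply/seteqP; split=> x.
        move=> [s sm xs]; exists (s l) => //; exists s => // i.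
        rewrite ltnS /upd; case: eqP => [->//|/eqP il il'].
        by apply: sm; rewrite ltn_neqAle il.
      move=> [j _ [s sm xs]]; exists s => // i il.
      by have := sm i (leqW il); rewrite /upd ltn_eqF.
    apply: C_cont => j x [s sm xs]; exists s => // i /sm.
    by rewrite /upd; case: eqP => // _ /leqW.
pose B k := [set x | exists2 s, below k m s & forall n, (n <= k)%N -> F n s x].
exists B; split.
- move=> k; pose M := (\max_(i < k) m i)%N.
  pose ext (f : {ffun 'I_k -> 'I_M.+1}) i :=
    if insub i is Some i' then f i' : nat else 0%N.
  pose ok (f : {ffun 'I_k -> 'I_M.+1}) := [forall i, (f i <= m i)%N].
  rewrite (_ : B k = \big[setU/set0]_(f : {ffun 'I_k -> 'I_M.+1} | ok f)
    \big[setI/setT]_(n < k.+1) F n (ext f)); last first.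
    rewrite -bigcup_seq_cond; under eq_bigcupr do
      rewrite -(bigcap_mkord k.+1 (fun n => F n (ext _))).
    apply/seteqP; split=> x.
      move=> [s sm xs].
      have sM i : (i < k)%N -> (s i < M.+1)%N.
        move=> ik; rewrite ltnS (leq_trans (sm i ik))//.
        exact: (leq_bigmax_cond (Ordinal ik)).
      pose f : {ffun 'I_k -> 'I_M.+1} := [ffun i : 'I_k => inord (s i)].
      have fE i : (i < k)%N -> ext f i = s i.
        by move=> ik; rewrite /ext insubT /= ffunE inordK// sM.
      exists f.
        rewrite /= mem_index_enum/=; apply/forallP => i.
        by rewrite ffunE inordK ?sM// sm.
      move=> n /=; rewrite ltnS => nk.
      have -> : F n (ext f) = F n s.
        by apply: Fl => i il; rewrite fE ?(leq_trans il).
      exact: xs.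
    move=> [f /= /andP[_ /forallP okf] xf]; exists (ext f).
      by move=> i ik; rewrite /ext insubT; exact: okf.
    by move=> n nk; have := xf n; rewrite /= ltnS; exact.
  apply: big_ind => // f _; exact: big_ind.
- move=> k; apply: C_up (mP k) => x [s sm xs].
  by exists s.
- move=> k x [s sm xs]; exists s => [i ik|n nk]; [apply: sm|apply: xs];
    exact: leqW.
- move=> x xB; rewrite AE.
  (* the prefix of length l extends to admissible branches of every depth *)
  pose Q l s := forall k, (l <= k)%N -> exists t,
    [/\ agree l s t, below k m t & forall n, (n <= k)%N -> F n t x].
  have [s sQ] : exists s, forall l, Q l s.
    apply: (@prefix_recursion Q id).
    + move=> l s t st Qs k lk; have [u [su um xu]] := Qs k lk; exists u.
      by split=> // i il; rewrite -st// su.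
    + by move=> k _; have [t tm xt] := xB k I; exists t.
    + move=> l s Qs; apply: contrapT => /forallNP nQ.
      have /choice[k kP] : forall j, exists k, (l < k)%N /\ ~ exists t,
          [/\ agree l.+1 (upd s l j) t, below k m t &
              forall n, (n <= k)%N -> F n t x].
        by move=> j; have := nQ j => /existsNP[k /not_implyP[? ?]]; exists k.
      pose kk := maxn l.+1 (\max_(j < (m l).+1) k j).
      have lkk : (l < kk)%N by rewrite leq_maxl.
      have [t [st tm xt]] := Qs kk (ltnW lkk).
      have tl := tm l lkk.
      have kkk : (k (t l) <= kk)%N.
        rewrite /kk leq_max; apply/orP; right.
        exact: (leq_bigmax_cond (Ordinal (tl : (t l < (m l).+1)%N))).
      apply: (kP (t l)).2; exists t; split.
      * move=> i; rewrite ltnS leq_eqVlt /upd; case: eqP => [->//|_ /= il].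
        exact: st.
      * by move=> i ik; apply: tm; exact: leq_trans ik kkk.
      * by move=> n nk; apply: xt; exact: leq_trans nk kkk.
  exists s => n; have [t [st _ xt]] := sQ n n (leqnn n).
  by rewrite (Fl n s t st); exact: xt.
Qed.

End capacitability.
End suslin.

(** * Separation from a convex cone *)

Section cone_separation.
Variables (R : realType) (V : lmodType R).
Implicit Types (K M : set V) (v w : V).

Definition convex_cone K := [/\ K 0,
  forall a v, 0 <= a -> K v -> K (a *: v) &
  forall v w, K v -> K w -> K (v + w)].

(** By Zorn's lemma there is a maximal cone that avoids - e; it is a half
space, for if both M + R_+ v and M - R_+ v contained - e, a positive
combination of the two representations would put - e in M. *)
Lemma maximal_cone K e : convex_cone K -> ~ K (- e) ->
  exists M, [/\ K `<=` M, convex_cone M, ~ M (- e) & forall v, M v \/ M (- v)].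
Proof.
move=> coneK Ke; pose proper M := [/\ K `<=` M, convex_cone M & ~ M (- e)].
have [F FP Ftot|M [PM maxM]] := @Zorn_bigcup V (fun M => M = set0 \/ proper M).
  have [[M [FM M0]]|nF] := pselect (exists M, F M /\ M !=set0); last first.
    left; apply/seteqP; split=> // v [M FM Mv].
    by case: nF; exists M; split=> //; exists v.
  have Fproper N v : F N -> N v -> proper N.
    by move=> FN Nv; have [N0|//] := FP _ FN; rewrite N0 in Nv.
  have [v0 Mv0] := M0; have [KM [M00 _ _] _] := Fproper _ _ FM Mv0.
  right; split=> [v Kv| |[N FN Ne]]; first by exists M => //; exact: KM.
    split=> [|a v a0 [N FN Nv]|v w [N FN Nv] [N' FN' N'w]]; first by exists M.
      by exists N => //; have [_ [_ NZ _] _] := Fproper _ _ FN Nv; exact: NZ.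
    have [NN'|N'N] := Ftot _ _ FN FN'.
      exists N' => //; have [_ [_ _ ND] _] := Fproper _ _ FN' N'w.
      by apply: ND => //; exact: NN'.
    exists N => //; have [_ [_ _ ND] _] := Fproper _ _ FN Nv.
    by apply: ND => //; exact: N'N.
  by have [_ _] := Fproper _ _ FN Ne; exact.
have K0 : K 0 by case: coneK.
have propK : proper K by split.
case: PM maxM => [->|[KM coneM Me] maxM].
  by move=> /(_ K) h; exfalso; apply: h; [split=> // /(_ _ K0)|right].
have [M0 MZ MD] := coneM; exists M; split=> // v.
(* otherwise the cone M + R_+ u would be proper and larger than M *)
have ext u : ~ M u -> exists m a, [/\ M m, 0 < a & - e = m + a *: u].
  move=> Mu; pose M' := [set w | exists m a, [/\ M m, 0 <= a & w = m + a *: u]].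
  have MM' : M `<=` M'.
    by move=> w Mw; exists w, 0; split=> //; rewrite scale0r addr0.
  have M'u : M' u by exists 0, 1; split=> //; rewrite scale1r add0r.
  have [m [a [Mm a0 eE]]] : M' (- e).
    apply: contrapT => M'e; apply: (maxM M').
      by split=> // /(_ _ M'u).
    right; split=> //; first by move=> w /KM /MM'.
    split; first exact: MM'.
      move=> b w b0 [m [a [Mm a0 ->]]]; exists (b *: m), (b * a).
      by rewrite scalerDr scalerA mulr_ge0//; split=> //; exact: MZ.
    move=> _ _ [m [a [Mm a0 ->]]] [m' [a' [Mm' a'0 ->]]].
    exists (m + m'), (a + a'); rewrite addr_ge0//; split=> //; first exact: MD.
    by rewrite scalerDl addrACA.
  exists m, a; split=> //; rewrite lt_neqAle a0 andbT.
  by apply/eqP => a00; apply: Me; rewrite eE -a00 scale0r addr0.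
apply: contrapT => /not_orP[/ext[m [a [Mm a0 eE]]] /ext[m' [a' [Mm' a'0 eE']]]].
apply: Me; rewrite (_ : - e = (a + a')^-1 *: (a' *: m + a *: m')).
  by apply: (MZ); [rewrite invr_ge0 addr_ge0 ?ltW|apply: (MD); apply: (MZ) => //; exact: ltW].
have aa' : a + a' != 0 by rewrite gt_eqF// addr_gt0.
apply: (scalerI aa'); rewrite scalerA divff// scale1r.
rewrite (_ : m = - e - a *: v); last by rewrite eE addrK.
rewrite (_ : m' = - e + a' *: v); last by rewrite eE' scalerN subrK.
rewrite !scalerDr (scalerN a' (a *: v)) !scalerA (mulrC a' a) addrACA addNr addr0.
by rewrite -scalerDl (addrC a).
Qed.

Variables (K : set V) (e : V).
Hypotheses (coneK : convex_cone K) (Ke : K e) (properK : ~ K (- e)).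

(** Vectors on which a functional that is nonnegative on K and normalized at e
has to be finite. *)
Definition dominated v := exists a, K (a *: e - v) /\ K (a *: e + v).

Lemma dominatedD v w : dominated v -> dominated w -> dominated (v + w).
Proof.
case: coneK => _ _ KD [a [a1 a2]] [b [b1 b2]]; exists (a + b).
by rewrite scalerDl opprD; split; rewrite addrACA; apply: (KD).
Qed.

Lemma dominatedZ a v : dominated v -> dominated (a *: v).
Proof.
case: coneK => _ KZ _ [b [b1 b2]]; exists (`|a| * b); rewrite -scalerA.
have [a0|a0] := leP 0 a.
  by rewrite ger0_norm// -scalerBr -scalerDr; split; apply: (KZ).
have Na : 0 <= - a by rewrite oppr_ge0 ltW.
rewrite ltr0_norm//; split; first by rewrite -scaleNr -scalerDr; exact: KZ.
by rewrite -(opprK (a *: v)) -scaleNr -scalerBr; exact: KZ.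
Qed.

(** The half space M preorders V totally modulo multiples of e, and eta v is
the cut of the real line made by the scalars a such that v - a e is in M.
Totality makes the cut symmetric, hence eta additive and not merely
superadditive. *)
Theorem cone_functional : exists eta : V -> R,
  [/\ forall v w, dominated v -> dominated w -> eta (v + w) = eta v + eta w,
      forall a v, dominated v -> eta (a *: v) = a * eta v,
      forall v, dominated v -> K v -> 0 <= eta v & eta e = 1].
Proof.
have [M [KM [M0 MZ MD] Me Mtot]] := maximal_cone coneK properK.
have Mae a : 0 <= a -> M (a *: e) by move=> a0; apply: (MZ) => //; exact: KM.
have Mneg a : M (a *: e) -> 0 <= a.
  move=> Ma; rewrite leNgt; apply/negP => a0; apply: Me.
  rewrite (_ : - e = (- a)^-1 *: (a *: e)); last first.
    by rewrite scalerA invrN mulNr mulVf ?lt_eqF// scaleN1r.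
  by apply: (MZ) => //; rewrite invr_ge0 oppr_ge0 ltW.
pose S v := [set a | M (v - a *: e)]; pose eta v := sup (S v).
have Sdown v a b : a <= b -> S v b -> S v a.
  move=> ab Sb; rewrite /S /= (_ : _ - _ = v - b *: e + (b - a) *: e).
    by apply: (MD) => //; apply: Mae; rewrite subr_ge0.
  by rewrite scalerBl addrA subrK.
have Sub v b : M (b *: e - v) -> ubound (S v) b.
  move=> Mb a Sa; rewrite -subr_ge0; apply: Mneg.
  by rewrite scalerBl -(subrK v (b *: e)) -addrA; apply: (MD).
have supS v : dominated v -> has_sup (S v).
  move=> [a [/KM Ma /KM M'a]]; split; last by exists a; exact: Sub.
  by exists (- a); rewrite /S /= scaleNr opprK addrC.
have lt_eta v a : dominated v -> a < eta v -> M (v - a *: e).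
  move=> /supS Sv /(sup_gt Sv.1)[b Sb ab]; exact: Sdown (ltW ab) Sb.
have gt_eta v a : dominated v -> eta v < a -> M (a *: e - v).
  move=> /supS Sv va; have [Ma|] := Mtot (v - a *: e); last by rewrite opprB.
  by move: va; rewrite ltNge (sup_upper_bound Sv).
have le_eta v a : dominated v -> M (v - a *: e) -> a <= eta v.
  by move=> /supS Sv; exact: sup_upper_bound.
have ge_eta v a : dominated v -> M (a *: e - v) -> eta v <= a.
  by move=> /supS Sv Ma; apply: ge_sup; [exact: Sv.1|exact: Sub].
have domD := dominatedD; have domZ := dominatedZ.
(* eta v is the only scalar near which both sides of the cut are in M *)
have near_eta v d : dominated v -> 0 < d ->
    M ((eta v + d) *: e - v) /\ M (v - (eta v - d) *: e).
  by move=> dv d0; split; [apply: gt_eta|apply: lt_eta];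
    rewrite // ?ltrDl// ltrBlDr ltrDl.
have eta_uniq v b : dominated v ->
    (forall d, 0 < d -> M ((b + d) *: e - v) /\ M (v - (b - d) *: e)) -> eta v = b.
  move=> dv vb; apply/eqP; rewrite eq_le; apply/andP; split.
    by apply/ler_addgt0Pr => d /vb[+ _]; exact: ge_eta.
  by apply/ler_addgt0Pr => d /vb[_]; rewrite -lerBlDr; exact: le_eta.
exists eta; split.
- move=> v w dv dw; apply: eta_uniq; first exact: domD.
  move=> d d0; have d20 : 0 < d / 2 by rewrite divr_gt0.
  have [v1 v2] := near_eta _ _ dv d20; have [w1 w2] := near_eta _ _ dw d20.
  split.
    rewrite (_ : _ - _ = ((eta v + d / 2) *: e - v) + ((eta w + d / 2) *: e - w)).
      exact: MD.
    by rewrite addrACA -scalerDl -opprD addrACA -splitr.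
  rewrite (_ : _ - _ = (v - (eta v - d / 2) *: e) + (w - (eta w - d / 2) *: e)).
    exact: MD.
  by rewrite addrACA -opprD -scalerDl addrACA -opprD -splitr.
- move=> a v dv; apply: eta_uniq; first exact: domZ.
  move=> d d0; pose d' := d / (`|a| + 1).
  have a1 : 0 < `|a| + 1 by rewrite ltr_wpDl.
  have [v1 v2] := near_eta _ _ dv (divr_gt0 d0 a1 : 0 < d').
  have ad' : 0 <= d - `|a| * d'.
    by rewrite subr_ge0 /d' mulrCA ger_pMr// ler_pdivrMr// mul1r lerDl.
  have lin x y z : x *: (y *: e - v) + z *: e = (x * y + z) *: e - x *: v.
    by rewrite scalerBr scalerA addrAC -scalerDl.
  have lin' x y z : x *: (v - y *: e) + z *: e = x *: v - (x * y - z) *: e.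
    by rewrite scalerBr scalerA scalerBl opprB addrA addrAC.
  have [a0|a0] := leP 0 a.
    rewrite ger0_norm// in ad'; split.
      rewrite (_ : _ - _ = a *: ((eta v + d') *: e - v) + (d - a * d') *: e).
        by apply: (MD); [exact: MZ|exact: Mae].
      by rewrite lin; congr (_ *: _ - _); ring.
    rewrite (_ : _ - _ = a *: (v - (eta v - d') *: e) + (d - a * d') *: e).
      by apply: (MD); [exact: MZ|exact: Mae].
    by rewrite lin'; congr (_ - _ *: _); ring.
  rewrite ltr0_norm// in ad'.
  have Na : 0 <= - a by rewrite oppr_ge0 ltW.
  split.
    rewrite (_ : _ - _ = - a *: (v - (eta v - d') *: e) + (d - - a * d') *: e).
      by apply: (MD); [exact: MZ|exact: Mae].
    by rewrite lin' scaleNr [RHS]addrC -(scaleNr _ e); congr (_ *: _ - _); ring.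
  rewrite (_ : _ - _ = - a *: ((eta v + d') *: e - v) + (d - - a * d') *: e).
    by apply: (MD); [exact: MZ|exact: Mae].
  by rewrite lin scaleNr opprK [RHS]addrC -scaleNr; congr (_ + _ *: _); ring.
- by move=> v dv Kv; apply: le_eta => //; rewrite scale0r subr0; exact: KM.
- apply: eta_uniq.
    exists 1; rewrite scale1r subrr; split; first by case: coneK.
    by case: coneK => _ _; exact.
  by move=> d d0; rewrite -{2 3}(scale1r e) -!scalerBl; split; apply: Mae; lra.
Qed.

End cone_separation.

(** * Integrals of bounded measurable functions *)

Section bounded_measurable.
Context d (T : measurableType d) (R : realType).
Implicit Types (f g : T -> R).

Definition bmeas f := measurable_fun [set: T] f /\ exists M, forall x, `|f x| <= M.

Lemma bmeas_bounded f : bmeas f -> bounded_fun f.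
Proof.
move=> [_ [M fM]]; exists M; split; first exact: num_real.
by move=> y My x _ /=; rewrite (le_trans (fM x))// ltW.
Qed.

Lemma bmeas_cst a : bmeas (cst a).
Proof. by split=> //; exists `|a|. Qed.

Lemma bmeasD f g : bmeas f -> bmeas g -> bmeas (fun x => f x + g x).
Proof.
move=> [mf [M fM]] [mg [N gN]]; split; first exact: measurable_funD.
by exists (M + N) => x; rewrite (le_trans (ler_normD _ _))// lerD.
Qed.

Lemma bmeasM f g : bmeas f -> bmeas g -> bmeas (fun x => f x * g x).
Proof.
move=> [mf [M fM]] [mg [N gN]]; split; first exact: measurable_funM.
by exists (M * N) => x; rewrite normrM ler_pM.
Qed.

Lemma bmeasZ a f : bmeas f -> bmeas (fun x => a * f x).
Proof. exact: bmeasM (bmeas_cst a). Qed.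

Lemma bmeasB f g : bmeas f -> bmeas g -> bmeas (fun x => f x - g x).
Proof.
move=> bf bg; rewrite (_ : (fun _ => _) = fun x => f x + -1 * g x).
  by apply: bmeasD => //; exact: bmeasZ.
by apply/funext => x; rewrite mulN1r.
Qed.

Lemma bmeas_norm f : bmeas f -> bmeas (fun x => `|f x|).
Proof.
move=> [mf [M fM]]; split; first exact: measurableT_comp.
by exists M => x; rewrite normr_id.
Qed.

Lemma bmeas_unit f : measurable_fun [set: T] f -> (forall x, 0 <= f x <= 1) -> bmeas f.
Proof.
move=> mf f01; split=> //; exists 1 => x.
by have /andP[f0 f1] := f01 x; rewrite ger0_norm.
Qed.

Lemma bmeas_indic (A : set T) : measurable A -> bmeas (\1_A : T -> R).
Proof.
move=> mA; apply: bmeas_unit; first exact: measurable_indic.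
by move=> x; rewrite indicE; case: (_ \in _); rewrite /= ?ler01 lexx.
Qed.

Variable mu : probability T R.

Lemma bmeas_integrable f : bmeas f -> mu.-integrable setT (EFin \o f).
Proof.
move=> bf; apply: measurable_bounded_integrable => //=.
- exact: fin_num_fun_lty.
- by case: bf.
- exact: bmeas_bounded.
Qed.

Lemma EFin_Rintegral f : bmeas f -> (\int[mu]_x f x)%:E = (\int[mu]_x (f x)%:E)%E.
Proof.
by move=> /bmeas_integrable bf; rewrite /Rintegral fineK//; exact: integrable_fin_num.
Qed.

Lemma bRintegralD f g : bmeas f -> bmeas g ->
  \int[mu]_x (f x + g x) = \int[mu]_x f x + \int[mu]_x g x.
Proof. by move=> bf bg; rewrite RintegralD//; exact: bmeas_integrable. Qed.

Lemma bRintegralB f g : bmeas f -> bmeas g ->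
  \int[mu]_x (f x - g x) = \int[mu]_x f x - \int[mu]_x g x.
Proof. by move=> bf bg; rewrite RintegralB//; exact: bmeas_integrable. Qed.

Lemma bRintegralZ a f : bmeas f -> \int[mu]_x (a * f x) = a * \int[mu]_x f x.
Proof. by move=> bf; rewrite RintegralZl//; exact: bmeas_integrable. Qed.

Lemma bRintegral_cst a : \int[mu]_x (cst a x) = a.
Proof.
have mu1 : (mu : {measure set T -> \bar R}) setT = 1%E := probability_setT mu.
have := @integral_cst _ T R mu setT measurableT a%:E.
by rewrite mu1 mule1 /Rintegral => ->.
Qed.

Lemma le_bRintegral f g : bmeas f -> bmeas g -> (forall x, f x <= g x) ->
  \int[mu]_x f x <= \int[mu]_x g x.
Proof.
by move=> bf bg fg; apply: le_Rintegral => //; exact: bmeas_integrable.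
Qed.

End bounded_measurable.

Lemma unit_bounded_fun (R : realType) (v : nat -> R) :
  (forall n, 0 <= v n <= 1) -> bounded_fun v.
Proof.
move=> v01; exists 1; split=> [|y y1 n _ /=]; first exact: num_real.
by have /andP[? ?] := v01 n; rewrite ger0_norm// (le_trans _ (ltW y1)).
Qed.

Section limsup.
Context d (T : measurableType d) (R : realType) (mu : probability T R).
Variable u : nat -> T -> R.
Hypotheses (mu_ : forall n, measurable_fun [set: T] (u n))
  (u01 : forall n x, 0 <= u n x <= 1).

Let ub x : bounded_fun (u ^~ x).
Proof. by apply: unit_bounded_fun. Qed.

Let hub x : has_ubound (range (u ^~ x)).
Proof. exact: bounded_fun_has_ubound. Qed.

Let hlb x : has_lbound (range (u ^~ x)).
Proof. exact: bounded_fun_has_lbound. Qed.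

Definition pointwise_limsup x := limn_sup (u ^~ x).
Local Notation h := pointwise_limsup.

Lemma limsup_le_sups x k : h x <= sups (u ^~ x) k.
Proof.
rewrite /h limn_supE//; apply: ge_inf; last by exists k.
exact: bounded_fun_has_lbound_sups.
Qed.

Lemma limsup_unit x : 0 <= h x <= 1.
Proof.
apply/andP; split.
  rewrite /h limn_supE//; apply: lb_le_inf => [|_ [k _ <-]].
    by exists (sups (u ^~ x) 0%N), 0%N.
  have /andP[u0 _] := u01 k x; apply: le_trans u0 _.
  by apply: ub_le_sup; [exact: has_ubound_sdrop|exists k => /=].
apply: le_trans (limsup_le_sups x 0) _; apply: ge_sup.
  by exists (u 0%N x), 0%N.
by move=> _ [k _ <-]; have /andP[] := u01 k x.
Qed.

Lemma measurable_limsup : measurable_fun [set: T] h.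
Proof. exact: measurable_fun_limn_sup. Qed.

(** The upper limit exceeds u k by at most the sum of the later increments,
and the increments sum to at most C / 2 ^ k in mean.  No almost everywhere
convergence is involved, so the upper limit can be used at every point. *)
Lemma limsup_integral_le (C : R) k : 0 <= C ->
  (forall n, \int[mu]_x `|u n.+1 x - u n x| <= C / (2 ^ n.+1)%:R) ->
  \int[mu]_x h x <= \int[mu]_x u k x + C / 2 ^+ k.
Proof.
move=> C0 uC; pose D (n : nat) (x : T) : R := `|u (k + n).+1 x - u (k + n)%N x|.
have bu n : bmeas (u n) by exact: bmeas_unit.
have bD n : bmeas (D n) by apply: bmeas_norm; exact: bmeasB.
have bh : bmeas h by apply: bmeas_unit; [exact: measurable_limsup|exact: limsup_unit].
have hD x : ((h x)%:E <= (u k x)%:E + \sum_(n <oo) (D n x)%:E)%E.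
  have Dge n : (0 <= (D n x)%:E)%E by rewrite lee_fin /D normr_ge0.
  have S0 : (0 <= \sum_(n <oo) (D n x)%:E)%E by exact: nneseries_ge0.
  have part m : \sum_(n < m) D n x <= fine (\sum_(n <oo) (D n x)%:E)%E \/
      (\sum_(n <oo) (D n x)%:E)%E = +oo%E.
    have := @nneseries_lim_ge R (fun n => (D n x)%:E) xpredT 0 m (fun n _ _ => Dge n).
    rewrite big_mkord sumEFin.
    by case: (\sum_(n <oo) _)%E S0 => [s| |] //= _ le_series; [left|right].
  have [->|/eqP Sfin] := eqVneq (\sum_(n <oo) (D n x)%:E)%E +oo%E.
    by rewrite addey ?leey.
  have {}part m : \sum_(n < m) D n x <= fine (\sum_(n <oo) (D n x)%:E)%E.
    by have [//|] := part m.
  rewrite -[X in (_ + X)%E]fineK; last first.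
    by rewrite ge0_fin_numE// ltey; exact/eqP.
  rewrite -EFinD lee_fin (le_trans (limsup_le_sups x k))//.
  apply: ge_sup; first by exists (u k x), k => /=.
  move=> _ [j /= kj <-]; rewrite -(subnKC kj).
  rewrite -lerBlDl (le_trans _ (part (j - k)%N))//.
  elim: (j - k)%N => [|m IH]; first by rewrite big_ord0 addn0 subrr.
  rewrite big_ord_recr /= addnS.
  rewrite (_ : _ - _ = (u (k + m)%N x - u k x) + (u (k + m).+1 x - u (k + m)%N x)).
    by rewrite lerD// ler_norm.
  by ring.
rewrite -lee_fin EFinD !EFin_Rintegral//.
have mD n : measurable_fun setT (fun x => (D n x)%:E).
  by apply/measurable_EFinP; case: (bD n).
have D0 n x : (0 <= (D n x)%:E)%E by rewrite lee_fin /D normr_ge0.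
have mS : measurable_fun setT (fun x => \sum_(n <oo) (D n x)%:E)%E.
  exact: ge0_emeasurable_sum.
apply: (@le_trans _ _ (\int[mu]_x ((u k x)%:E + \sum_(n <oo) (D n x)%:E))%E).
  apply: ge0_le_integral => //.
  - by move=> x _; rewrite lee_fin; have /andP[] := limsup_unit x.
  - by apply/measurable_EFinP; case: bh.
  - by apply: emeasurable_funD => //; apply/measurable_EFinP; case: (bu k).
rewrite ge0_integralD//.
- rewrite leeD2l// integral_nneseries//.
  rewrite -(cvg_lim _ (@cvg_geometric_eseries_half R C k))//.
  apply: lee_nneseries => [n _ _|n _]; first exact: integral_ge0.
  by rewrite -EFin_Rintegral// lee_fin (le_trans (uC _))// addnS (addnC n).
- by move=> x _; rewrite lee_fin; have /andP[] := u01 k x.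
- by apply/measurable_EFinP; case: (bu k).
- by move=> x _; exact: nneseries_ge0.
Qed.

End limsup.

(** * Closedness of the set of dominating pairs *)

Section dual_pairs.
Context d1 (X : measurableType d1) d2 (Y : measurableType d2) (R : realType).
Variables (mu : probability X R) (nu : probability Y R).
Implicit Types (G : set (X * Y * R)) (c : R) (p q : (X -> R) * (Y -> R)).

Definition cost p := \int[mu]_x p.1 x + \int[nu]_y p.2 y.

Definition unit_pair p :=
  [/\ measurable_fun [set: X] p.1, measurable_fun [set: Y] p.2,
      forall x, 0 <= p.1 x <= 1 & forall y, 0 <= p.2 y <= 1].

Definition covers G p := forall w, G w -> w.2 <= p.1 w.1.1 + p.2 w.1.2.

(** A pair dominates a set G of points (x, y, t) rather than a function, so
that increasing unions of such sets replace suprema of functions. *)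
Definition hedges G c p := [/\ unit_pair p, covers G p & cost p <= c].

Let energy p := \int[mu]_x (p.1 x * p.1 x) + \int[nu]_y (p.2 y * p.2 y).

Let mid p q : (X -> R) * (Y -> R) :=
  (fun x => 2^-1 * (p.1 x + q.1 x), fun y => 2^-1 * (p.2 y + q.2 y)).

Lemma unit_pair_bmeas p : unit_pair p -> bmeas p.1 /\ bmeas p.2.
Proof. by move=> [m1 m2 u1 u2]; split; exact: bmeas_unit. Qed.

Let parallelogram d (T : measurableType d) (la : probability T R) (f g : T -> R) :
  bmeas f -> bmeas g ->
  \int[la]_x ((f x - g x) * (f x - g x)) =
  2 * \int[la]_x (f x * f x) + 2 * \int[la]_x (g x * g x) -
  4 * \int[la]_x ((2^-1 * (f x + g x)) * (2^-1 * (f x + g x))).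
Proof.
move=> bf bg.
have bmid : bmeas (fun x => 2^-1 * (f x + g x)) by apply/bmeasZ/bmeasD.
rewrite -!bRintegralZ; try exact: bmeasM.
rewrite -bRintegralD; try by apply/bmeasZ/bmeasM.
rewrite -bRintegralB; first by congr Rintegral; apply/funext => x; field.
  by apply: bmeasD; apply/bmeasZ/bmeasM.
by apply/bmeasZ/bmeasM.
Qed.

Let L1_le_L2 d (T : measurableType d) (la : probability T R) (f g : T -> R) (s : R) :
  bmeas f -> bmeas g -> 0 < s ->
  \int[la]_x `|f x - g x| <= s + s^-1 * \int[la]_x ((f x - g x) * (f x - g x)).
Proof.
move=> bf bg s0; have bfg := bmeasB bf bg.
rewrite -bRintegralZ; last exact: bmeasM.
rewrite -{1}(bRintegral_cst la s) -bRintegralD; last 2 first.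
- exact: bmeas_cst.
- by apply/bmeasZ/bmeasM.
apply: le_bRintegral.
- exact: bmeas_norm.
- by apply: bmeasD; [exact: bmeas_cst|apply/bmeasZ/bmeasM].
move=> x /=; set a := f x - g x.
have -> : a * a = `|a| * `|a| by rewrite -normrM ger0_norm// -expr2 sqr_ge0.
rewrite -(ler_pM2l s0) mulrDr mulrA divff ?gt_eqF// mul1r.
have := sqr_ge0 (`|a| - s); have := normr_ge0 a; nra.
Qed.

Let energy_ge0 p : 0 <= energy p.
Proof. by rewrite addr_ge0//; apply: Rintegral_ge0 => x _; rewrite -expr2 sqr_ge0. Qed.

Let energy_le2 p : unit_pair p -> energy p <= 2.
Proof.
move=> up; have [b1 b2] := unit_pair_bmeas up; case: up => [m1 m2 u1 u2].
rewrite (_ : 2 = 1 + 1)// lerD//.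
  rewrite -[leRHS](bRintegral_cst mu); apply: le_bRintegral => [| |x /=];
    [exact: bmeasM|exact: bmeas_cst|].
  by have /andP[? ?] := u1 x; rewrite mulr_ile1.
rewrite -[leRHS](bRintegral_cst nu).
apply: le_bRintegral => [| |x /=];
    [exact: bmeasM|exact: bmeas_cst|].
by have /andP[? ?] := u2 x; rewrite mulr_ile1.
Qed.

Let hedges_mid G c p q : hedges G c p -> hedges G c q -> hedges G c (mid p q).
Proof.
move=> [up Gp cp] [uq Gq cq].
have [bp1 bp2] := unit_pair_bmeas up; have [bq1 bq2] := unit_pair_bmeas uq.
case: up uq => [mp1 mp2 p1 p2] [mq1 mq2 q1 q2].
split.
- split=> /=; [by case: (bmeasZ 2^-1 (bmeasD bp1 bq1))|
               by case: (bmeasZ 2^-1 (bmeasD bp2 bq2))| |].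
  + by move=> x; have /andP[? ?] := p1 x; have /andP[? ?] := q1 x; lra.
  + by move=> x; have /andP[? ?] := p2 x; have /andP[? ?] := q2 x; lra.
- by move=> w Gw; have := Gp _ Gw; have := Gq _ Gw => /=; lra.
- rewrite /cost /= !bRintegralZ; [|exact: bmeasD|exact: bmeasD].
  by rewrite !bRintegralD//; move: cp cq; rewrite /cost; lra.
Qed.

(** The pairs for stage n form a convex set, and these sets decrease with n.
Almost minimizers of the energy, taken at stages far out, have midpoints of
almost the same energy, hence they are close in L2 and a fortiori in L1.
Their coordinatewise upper limits dominate each G n everywhere, because the
upper limit of a sum is at most the sum of the upper limits. *)
Theorem hedges_limit (G : nat -> set (X * Y * R)) (c : nat -> R) :
  (forall n, G n `<=` G n.+1) -> (forall n, c n.+1 <= c n) ->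
  (forall n, exists p, hedges (G n) (c n) p) ->
  exists p, forall n, hedges (G n) (c n) p.
Proof.
move=> Gup cdown Hn.
have Gmono m n : (m <= n)%N -> G m `<=` G n.
  move=> /subnKC <-; elim: (n - m)%N => [|k IH]; first by rewrite addn0.
  by rewrite addnS; exact: subset_trans IH (Gup _).
have cmono m n : (m <= n)%N -> c n <= c m.
  move=> /subnKC <-; elim: (n - m)%N => [|k IH]; first by rewrite addn0.
  by rewrite addnS; exact: le_trans (cdown _) IH.
have mono m n p : (m <= n)%N -> hedges (G n) (c n) p -> hedges (G m) (c m) p.
  move=> mn [up Gp cp]; split=> //; last exact: le_trans cp (cmono _ _ mn).
  by move=> w /(Gmono _ _ mn); exact: Gp.
pose E n := [set energy p | p in hedges (G n) (c n)].
pose a n := inf (E n).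
have Elb n : has_lbound (E n) by exists 0 => _ [p _ <-].
have a_le n p : hedges (G n) (c n) p -> a n <= energy p.
  by move=> hp; apply: ge_inf => //; exists p.
have hsup : has_sup (range a).
  split; first by exists (a 0%N), 0%N.
  exists 2 => _ [n _ <-]; have [p hp] := Hn n.
  by apply: le_trans (a_le _ _ hp) _; apply: energy_le2; case: hp.
pose A := sup (range a).
have a_homo m n : (m <= n)%N -> a m <= a n.
  move=> mn; apply: lb_le_inf; first by have [p hp] := Hn n; exists (energy p), p.
  by move=> _ [p hp <-]; apply: a_le; exact: mono hp.
pose s k : R := (2 ^+ k)^-1.
have s0 k : 0 < s k by rewrite invr_gt0 exprn_gt0.
have sS k : s k = 2 * s k.+1 by rewrite /s exprS invfM mulrA divff ?mul1r.
(* energies within dl k of the infimum put neighbours at L2 distance s k *)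
pose dl k := s k * s k / 8.
have dl0 k : 0 < dl k by rewrite divr_gt0// mulr_gt0.
have /choice[p pP] : forall k, exists p, exists N, [/\ (k <= N)%N,
    hedges (G N) (c N) p, A - dl k < a N & energy p < A + dl k].
  move=> k.
  have [_ [N _ <-] AN] := sup_adherent (dl0 k) hsup.
  have [N' [kN' NN']] : exists N', (k <= N')%N /\ (N <= N')%N.
    by exists (maxn k N); rewrite leq_maxl leq_maxr.
  have [|_ [p hp <-] Ep] := @inf_adherent _ (E N') _ (dl0 k).
    by split=> //; have [p hp] := Hn N'; exists (energy p), p.
  exists p, N'; split=> //.
    by apply: lt_le_trans AN _; exact: a_homo.
  apply: lt_le_trans Ep _; rewrite lerD2r; exact: sup_upper_bound.
have up k : unit_pair (p k) by have [N [_ []]] := pP k.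
have b1 k : bmeas (p k).1 by have [] := unit_pair_bmeas (up k).
have b2 k : bmeas (p k).2 by have [] := unit_pair_bmeas (up k).
have dist k : \int[mu]_x (((p k.+1).1 x - (p k).1 x) * ((p k.+1).1 x - (p k).1 x)) +
    \int[nu]_y (((p k.+1).2 y - (p k).2 y) * ((p k.+1).2 y - (p k).2 y)) <= s k * s k.
  have [N [kN hN aN eN]] := pP k; have [M [kM hM aM eM]] := pP k.+1.
  have dlS : dl k.+1 <= dl k.
    by rewrite /dl (sS k); have := s0 k.+1; nra.
  have amid : A - dl k < energy (mid (p k.+1) (p k)).
    have hmid : hedges (G (minn N M)) (c (minn N M)) (mid (p k.+1) (p k)).
      apply: hedges_mid; [apply: mono hM|apply: mono hN].
        exact: geq_minr.
      exact: geq_minl.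
    apply: lt_le_trans (a_le _ _ hmid).
    rewrite minnE -minnE /minn; case: ifP => _ //.
    by apply: le_lt_trans aM; rewrite lerD2l lerN2.
  rewrite !parallelogram//; move: eN eM amid; rewrite /energy /mid /=.
  by rewrite (_ : s k * s k = 8 * dl k); [lra|rewrite /dl; field].
have sle k z : z <= s k * s k -> s k + (s k)^-1 * z <= 4 / (2 ^ k.+1)%:R.
  rewrite natrX -[_ ^- _]/(s k.+1) => zk.
  rewrite -(ler_pM2l (s0 k)) mulrDr mulrA divff ?gt_eqF// mul1r.
  by move: zk; rewrite (sS k); have := s0 k.+1; nra.
have cauchy1 k : \int[mu]_x `|(p k.+1).1 x - (p k).1 x| <= 4 / (2 ^ k.+1)%:R.
  apply: le_trans (L1_le_L2 mu (b1 k.+1) (b1 k) (s0 k)) _.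
  apply: sle; apply: le_trans (dist k); rewrite lerDl//.
  by apply: Rintegral_ge0 => x _; rewrite -expr2 sqr_ge0.
have cauchy2 k : \int[nu]_x `|(p k.+1).2 x - (p k).2 x| <= 4 / (2 ^ k.+1)%:R.
  apply: le_trans (L1_le_L2 nu (b2 k.+1) (b2 k) (s0 k)) _.
  apply: sle; apply: le_trans (dist k); rewrite lerDr//.
  by apply: Rintegral_ge0 => x _; rewrite -expr2 sqr_ge0.
pose h := pointwise_limsup (fun k => (p k).1).
pose g := pointwise_limsup (fun k => (p k).2).
have u1 k x : 0 <= (p k).1 x <= 1 by case: (up k).
have u2 k x : 0 <= (p k).2 x <= 1 by case: (up k).
have m1 k : measurable_fun setT (p k).1 by case: (up k).
have m2 k : measurable_fun setT (p k).2 by case: (up k).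
exists (h, g) => n; split.
- by split; [exact: measurable_limsup|exact: measurable_limsup|
    exact: limsup_unit|exact: limsup_unit].
- move=> [[x y] t] Gw /=.
  have bu1 : bounded_fun (fun k => (p k).1 x) by exact: unit_bounded_fun.
  have bu2 : bounded_fun (fun k => (p k).2 y) by exact: unit_bounded_fun.
  apply: le_trans (le_limn_supD bu1 bu2).
  have bu12 := bounded_funD bu1 bu2.
  rewrite limn_supE//; apply: lb_le_inf.
    by exists (sups ((fun k => (p k).1 x) \+ (fun k => (p k).2 y)) 0%N), 0%N.
  move=> _ [k _ <-]; pose K := maxn k n.
  have [N [KN [_ cov _] _ _]] := pP K.
  have := cov _ (Gmono _ _ (leq_trans (leq_maxr k n) KN) _ Gw) => /= tK.
  apply: le_trans tK _; apply: ub_le_sup; last by exists K => //=; rewrite leq_maxl.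
  by apply: has_ubound_sdrop; exact: bounded_fun_has_ubound.
- apply/ler_addgt0Pr => e e0.
  pose k := maxn n (Num.bound (8 / e)).
  have [N [kN [_ _ ck] _ _]] := pP k.
  have nN : (n <= N)%N by apply: leq_trans kN; rewrite leq_maxl.
  have ke : 8 * s k <= e.
    rewrite /s ler_pdivrMr ?exprn_gt0// mulrC -ler_pdivrMr//.
    apply: le_trans (ltW (archi_boundP _)) _; first by rewrite divr_ge0// ltW.
    rewrite -natrX ler_nat; apply: leq_trans (ltnW (ltn_expl k _)) => //.
    by rewrite leq_maxr.
  have hk : \int[mu]_x h x <= \int[mu]_x (p k).1 x + 4 / 2 ^+ k.
    exact: limsup_integral_le.
  have gk : \int[nu]_x g x <= \int[nu]_x (p k).2 x + 4 / 2 ^+ k.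
    exact: limsup_integral_le.
  have := cmono _ _ nN; move: ck ke hk gk; rewrite /cost /s /=; lra.
Qed.

End dual_pairs.

(** * Countable additivity from compact regularity *)

Definition rectangle_display : Type -> Type -> measure_display.
Proof. exact. Qed.

Section rectangles.
Context d1 (X : measurableType d1) d2 (Y : measurableType d2).

Definition rectangle_type : Type := (X * Y)%type.

Definition rectangles : set (set rectangle_type) :=
  [set A `*` B | A in measurable & B in measurable].

Let rectangles0 : rectangles set0.
Proof. by exists set0 => //; exists set0 => //; rewrite setX0. Qed.

Let rectanglesI : setI_closed rectangles.
Proof.
move=> _ _ [A mA [B mB <-]] [C mC [D mD <-]].
exists (A `&` C); first exact: measurableI.
by exists (B `&` D); [exact: measurableI|rewrite setXI].
Qed.

(** A difference of rectangles splits into a strip over the part of the first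
side that is removed and a rectangle over the part that is kept. *)
Let rectanglesD : semi_setD_closed rectangles.
Proof.
move=> _ _ [A mA [B mB <-]] [C mC [D mD <-]].
pose L : set rectangle_type := (A `\` C) `*` B.
pose M : set rectangle_type := (A `&` C) `*` (B `\` D).
exists [set L; M]; split.
- exact: finite_set2.
- move=> _ [->|->].
  + by exists (A `\` C); [exact: measurableD|exists B].
  + by exists (A `&` C); [exact: measurableI|exists (B `\` D) => //; exact: measurableD].
- rewrite bigcup_setU !bigcup_set1; apply/seteqP; split=> -[x y] /=.
    move=> [[Ax By] /not_andP]; have [Cx|nCx] := pselect (C x).
      by case=> // nDy; right.
    by left.
  by move=> [[[Ax nCx] By]|[[Ax Cx] [By nDy]]]; split=> // -[].
- have LM : L `&` M = set0.
    by apply/seteqP; split=> // -[x y] [[[_ nCx] _] [[_ Cx] _]].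
  move=> _ _ [->|->] [->|->] //; first by rewrite LM => -[].
  by rewrite setIC LM => -[].
Qed.

HB.instance Definition _ := Pointed.on rectangle_type.
HB.instance Definition _ := @isSemiRingOfSets.Build (rectangle_display X Y)
  rectangle_type rectangles rectangles0 rectanglesI rectanglesD.

End rectangles.

(** One approximation from both sides: a compact set inside and an open set
outside, with a small gap. *)
Definition compact_regular (X : ptopologicalType) (R : realType)
    (mu : set (borel X) -> \bar R) :=
  forall (A : set (borel X)) (e : R), measurable A -> 0 < e ->
  exists K U : set X, [/\ compact K, open U, measurable (K : set (borel X)),
    K `<=` A /\ A `<=` U & (mu (U `\` K) <= e%:E)%E].

Lemma open_borel (X : ptopologicalType) (U : set X) :
  open U -> measurable (U : set (borel X)).
Proof. exact: sub_sigma_algebra. Qed.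

Lemma openX (X Y : topologicalType) (U : set X) (V : set Y) :
  open U -> open V -> open (U `*` V).
Proof.
move=> oU oV; rewrite openE => -[x y] [/= Ux Vy].
by exists (U, V) => //; split; exact: open_nbhs_nbhs.
Qed.

Section coupling_extension.
Context (X Y : ptopologicalType) (R : realType).
Variables (mu : probability (borel X) R) (nu : probability (borel Y) R).
Hypotheses (mu_reg : compact_regular mu) (nu_reg : compact_regular nu).
Let Omega : ptopologicalType := (X * Y)%type.
Local Notation rect := (rectangle_type (borel X) (borel Y)).
Hypothesis borel_rect : forall A : set Omega, open A ->
  <<s @rectangles _ (borel X) _ (borel Y) >> A.

Variable eta : set Omega -> R.
Hypotheses (eta_ge0 : forall A, 0 <= eta A)
  (etaU : forall A B, A `&` B = set0 -> eta (A `|` B) = eta A + eta B)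
  (eta_mu : forall A : set (borel X), measurable A -> (eta (A `*` setT))%:E = mu A)
  (eta_nu : forall B : set (borel Y), measurable B -> (eta (setT `*` B))%:E = nu B).

Let eta0 : eta set0 = 0.
Proof.
by have := etaU (setI0 set0); rewrite setU0 => /eqP; rewrite -subr_eq subrr => /eqP.
Qed.

Let eta_le A B : A `<=` B -> eta A <= eta B.
Proof.
move=> AB; rewrite -(setDUK AB) etaU ?lerDl//.
by rewrite setDE setICA setICr setI0.
Qed.

Let etaU_le A B : eta (A `|` B) <= eta A + eta B.
Proof.
rewrite (_ : A `|` B = A `|` (B `\` A)); last by rewrite setUDr // setDv setD0.
rewrite etaU ?lerD2l ?eta_le//.
by rewrite setDE setICA setICr setI0.
Qed.

Let eta_bigU_le (W : nat -> set Omega) N :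
  eta (\big[setU/set0]_(i < N) W i) <= \sum_(i < N) eta (W i).
Proof.
elim: N => [|N IH]; first by rewrite !big_ord0 eta0.
rewrite !big_ord_recr /=; apply: le_trans (etaU_le _ _) _.
by rewrite lerD2r.
Qed.

Definition rect_content (A : set rect) : \bar R := (eta A)%:E.

Let rect_content_ge0 A : (0 <= rect_content A)%E.
Proof. by rewrite lee_fin. Qed.

Let rect_content_additive : measure_function.semi_additive rect_content.
Proof.
move=> F n _ tF _; rewrite /rect_content sumEFin; congr EFin.
elim: n => [|n IH]; first by rewrite !big_ord0 eta0.
rewrite !big_ord_recr /= etaU ?IH//.
rewrite -bigcup_mkord -subset0 => x [[/= m + Amx] Anx].
by rewrite (tF m n) ?ltnn//=; exists x.
Qed.

HB.instance Definition _ := isContent.Build _ rect R rect_content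
  rect_content_ge0 rect_content_additive.

(** The points of A x B outside K x L have their first coordinate in A \ K or
their second one in B \ L, and the marginals control these two strips. *)
Let eta_rect_le (K A : set (borel X)) (L B : set (borel Y)) (e : R) :
  measurable K -> measurable A -> measurable L -> measurable B ->
  (mu (A `\` K) <= e%:E)%E -> (nu (B `\` L) <= e%:E)%E ->
  eta (A `*` B) <= eta (K `*` L) + (e + e).
Proof.
move=> mK mA mL mB muAK nuBL.
rewrite -eta_mu ?lee_fin in muAK; last exact: measurableD.
rewrite -eta_nu ?lee_fin in nuBL; last exact: measurableD.
apply: (@le_trans _ _ (eta ((K `*` L) `|`
    (((A `\` K) `*` setT) `|` (setT `*` (B `\` L)))))).
  apply: eta_le => -[x y] [/= Ax By].
  have [Kx|nKx] := pselect (K x); last by right; left.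
  by have [Ly|nLy] := pselect (L y); [left|right; right].
apply: le_trans (etaU_le _ _) _; rewrite lerD2l.
by apply: le_trans (etaU_le _ _) _; exact: lerD.
Qed.

(** A compact rectangle that almost fills A x B is covered by open rectangles
slightly larger than the given ones.  Finitely many suffice, so that finite
subadditivity of eta yields countable subadditivity up to the errors. *)
Let rect_content_subadditive : measurable_subset_sigma_subadditive rect_content.
Proof.
move=> _ F mF [A mA [B mB <-]] AF.
apply/lee_addgt0Pr => e e0.
(* two errors e / 4 for the compact sides, and e / 2 for the open covers *)
pose e4 := e / 4; have e40 : 0 < e4 by rewrite divr_gt0.
have [K [U [cK oU mK [KA AU] muK]]] := mu_reg mA e40.
have [L [V [cL oV mL [LB BV] nuL]]] := nu_reg mB e40.
have {}muK : (mu (A `\` K) <= e4%:E)%E.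
  apply: le_trans muK; apply: le_measure; rewrite ?inE.
  - exact: measurableD.
  - by apply: measurableD => //; exact: open_borel.
  - by move=> x [/AU].
have {}nuL : (nu (B `\` L) <= e4%:E)%E.
  apply: le_trans nuL; apply: le_measure; rewrite ?inE.
  - exact: measurableD.
  - by apply: measurableD => //; exact: open_borel.
  - by move=> x [/BV].
pose dl n : R := (e / 2) / (2 ^ n.+1)%:R.
have dl0 n : 0 < dl n / 2 by rewrite !divr_gt0// ltr0n expn_gt0.
have Fapprox n : exists W : set Omega, [/\ open W, F n `<=` W & eta W <= eta (F n) + dl n].
  have [A' mA' [B' mB' FE]] := mF n.
  have [C [U' [_ oU' mC [CA AU''] muC]]] := mu_reg mA' (dl0 n).
  have [D [V' [_ oV' mD [DB BV'] nuD]]] := nu_reg mB' (dl0 n).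
  exists (U' `*` V'); split.
  - exact: openX.
  - by rewrite -FE => -[x y] [/AU'' ? /BV' ?].
  - rewrite -FE (splitr (dl n)); apply: eta_rect_le => //; try exact: open_borel.
    + apply: le_trans muC; apply: le_measure; rewrite ?inE.
      * by apply: measurableD => //; exact: open_borel.
      * by apply: measurableD => //; exact: open_borel.
      * by move=> x [? nA]; split=> // /CA.
    + apply: le_trans nuD; apply: le_measure; rewrite ?inE.
      * by apply: measurableD => //; exact: open_borel.
      * by apply: measurableD => //; exact: open_borel.
      * by move=> x [? nB]; split=> // /DB.
move: Fapprox => /choice[W Wp].
have cKL : compact (K `*` L : set Omega) by exact: compact_setX.
have [N KLN] : exists N, K `*` L `<=` \big[setU/set0]_(i < N) W i.
  move: cKL; rewrite compact_cover => /(_ nat setT W)[].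
  - by move=> n _; have [] := Wp n.
  - move=> [x y] [Kx Ly]; have [|n _ Fn] := AF (x, y); first by split; [exact: KA|exact: LB].
    by exists n => //; have [_ + _] := Wp n; exact.
  - move=> D _ KD; exists (\max_(i <- finmap.enum_fset D) i.+1)%N.
    move=> w /KD[n /= nD Wn]; rewrite -bigcup_mkord; exists n => //=.
    exact: (@leq_bigmax_seq _ (finmap.enum_fset D) xpredT (fun i => i.+1)).
apply: (@le_trans _ _ (\sum_(n < N) (rect_content (F n) + (dl n)%:E) + (e / 2)%:E)%E).
  rewrite /rect_content; under eq_bigr do rewrite -EFinD.
  rewrite sumEFin -EFinD lee_fin.
  apply: le_trans (eta_rect_le mK mA mL mB muK nuL) _; apply: lerD.
    apply: le_trans (eta_le KLN) _; apply: le_trans (eta_bigU_le _ _) _.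
    by apply: ler_sum => i _; have [] := Wp i.
  by rewrite /e4; lra.
rewrite [in leRHS](splitr e) EFinD addeA leeD2r//.
apply: le_trans (@epsilon_trick _ _ _ xpredT _ _); rewrite //; last by rewrite divr_ge0// ltW.
rewrite -(big_mkord xpredT (fun n => rect_content (F n) + (dl n)%:E)%E).
by apply: nneseries_lim_ge => n _ _; rewrite adde_ge0// lee_fin; have := dl0 n; lra.
Qed.

HB.instance Definition _ := Content_SigmaSubAdditive_isMeasure.Build _ R rect
  rect_content rect_content_subadditive.

Let ext : {measure set (g_sigma_algebraType (@measurable _ rect)) -> \bar R} :=
  measure_extension rect_content.

Definition coupling_measure (A : set (borel Omega)) : \bar R := ext A.

Let borel_sub (A : set (borel Omega)) : measurable A ->
  measurable (A : set (g_sigma_algebraType (@measurable _ rect))).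
Proof.
move: A; apply: smallest_sub; last exact: borel_rect.
exact: smallest_sigma_algebra.
Qed.

Let cm0 : coupling_measure set0 = 0%E. Proof. exact: measure0. Qed.
Let cm_ge0 A : (0 <= coupling_measure A)%E. Proof. exact: measure_ge0. Qed.
Let cm_additive : semi_sigma_additive coupling_measure.
Proof.
move=> F mF tF mUF; apply: (@measure_semi_sigma_additive _ _ _ ext) => //.
- by move=> i; exact: borel_sub.
- exact: borel_sub.
Qed.

HB.instance Definition _ := isMeasure.Build _ _ _ coupling_measure cm0 cm_ge0 cm_additive.

Let cm_rect (A : set (borel X)) (B : set (borel Y)) : measurable A -> measurable B ->
  coupling_measure (A `*` B) = (eta (A `*` B))%:E.
Proof.
move=> mA mB; rewrite -[RHS]/(rect_content (A `*` B)).
by apply: measurable_mu_extE; exists A => //; exists B.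
Qed.

Let cmT : coupling_measure setT = 1%E.
Proof.
by rewrite -setXTT cm_rect// eta_mu// probability_setT.
Qed.

HB.instance Definition _ := Measure_isProbability.Build _ _ R coupling_measure cmT.

(** Only the two marginals are assumed countably additive: their compact
regularity forces countable additivity of eta on the semiring of rectangles,
and the extension theorem for measures applies. *)
Theorem coupling_extension : exists m : probability (borel Omega) R,
  forall (A : set (borel X)) (B : set (borel Y)), measurable A -> measurable B ->
  m (A `*` B) = (eta (A `*` B))%:E.
Proof. by exists coupling_measure; exact: cm_rect. Qed.

End coupling_extension.

(** * Closed subsets of Euclidean space *)

Definition countable_base (X : topologicalType) := exists B : nat -> set X,
  (forall n, open (B n)) /\
  forall (U : set X) x, open U -> U x -> exists n, B n x /\ B n `<=` U.

Definition sigma_compact_opens (X : topologicalType) :=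
  forall U : set X, open U -> exists K : nat -> set X,
    [/\ forall n, compact (K n), forall n, closed (K n) & U = \bigcup_n K n].

(** With countable bases, an open set of the product is the union of the
countably many basic rectangles that it contains. *)
Lemma open_sigma_rectangles (X Y : ptopologicalType) (W : set (X * Y)) :
  countable_base X -> countable_base Y -> open W ->
  <<s @rectangles _ (borel X) _ (borel Y) >> W.
Proof.
move=> [A [oA Abase]] [B [oB Bbase]] oW.
pose F n m := if pselect (A n `*` B m `<=` W) then A n `*` B m else set0.
rewrite (_ : W = \bigcup_n \bigcup_m F n m).
  apply: sigma_algebra_bigcup => n; apply: sigma_algebra_bigcup => m.
  apply: sub_sigma_algebra; rewrite /F; case: pselect => [?|?] /=.
    by exists (A n); [exact: (open_borel (oA n))|
      exists (B m) => //; exact: (open_borel (oB m))].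
  by exists set0 => //; exists set0 => //; rewrite setX0.
apply/seteqP; split=> -[x y].
  move=> Wxy; have [[U V] /= [Ux Vy] UVW] : nbhs (x, y) W by exact: open_nbhs_nbhs.
  move: Ux Vy; rewrite !nbhsE /= => -[U' [oU' U'x] U'U] [V' [oV' V'y] V'V].
  have [n [An AU]] := Abase _ _ oU' U'x; have [m [Bm BV]] := Bbase _ _ oV' V'y.
  exists n => //; exists m => //; rewrite /F; case: pselect => // nAB.
  exfalso; apply: nAB => -[x' y'] [Ax' By']; apply: (UVW (x', y')).
  by split=> /=; [exact/U'U/AU|exact/V'V/BV].
by move=> [n _ [m _]]; rewrite /F; case: pselect => // AB; exact: AB.
Qed.

Section regularity.
Context (X : ptopologicalType) (R : realType) (mu : probability (borel X) R).
Hypothesis sigmaK : sigma_compact_opens X.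

Let reg (A : set (borel X)) := measurable A /\ forall e : R, 0 < e ->
  exists K U : set X, [/\ compact K, closed K, open U,
    K `<=` A /\ A `<=` U & (mu (U `\` K) <= e%:E)%E].

Let closed_borel (K : set X) : closed K -> measurable (K : set (borel X)).
Proof.
by rewrite -openC => /open_borel oK; rewrite -(setCK K); exact: measurableC.
Qed.

Let tail_small (A : nat -> set (borel X)) (e : R) : (forall n, measurable (A n)) -> 0 < e ->
  exists N, (mu (\bigcup_n A n `\` \big[setU/set0]_(i < N) A i) <= e%:E)%E.
Proof.
move=> mA e0; pose B N := \bigcup_n A n `\` \big[setU/set0]_(i < N) A i.
have mU : measurable (\bigcup_n A n) by exact: bigcupT_measurable.
have mB N : measurable (B N) by apply: measurableD => //; exact: bigsetU_measurable.
have : mu \o B @ \oo --> mu (\bigcap_N B N).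
  apply: nonincreasing_cvg_mu => //.
  - by rewrite -ge0_fin_numE ?fin_num_measure.
  - exact: bigcap_measurableType.
  - move=> m n mn; apply/subsetPset; apply: setDS.
    by rewrite -!bigcup_mkord => x [i /= im Ax]; exists i => //=; exact: leq_trans mn.
rewrite (_ : \bigcap_N B N = set0) ?measure0; last first.
  apply/seteqP; split=> // x xB; have [[n _ Anx] _] := xB 0%N I.
  have [_] := xB n.+1 I; apply; rewrite -bigcup_mkord; by exists n => /=.
move=> /fine_cvgP[_ /cvgrPdist_le /(_ _ e0)[N _ /(_ N (leqnn N))]] /=.
rewrite sub0r normrN ger0_norm ?fine_ge0// => muB; exists N.
by rewrite -lee_fin fineK ?fin_num_measure in muB.
Qed.

Let reg_open (U : set X) : open U -> reg U.
Proof.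
move=> oU; split; first exact: open_borel.
move=> e e0; have [K [cK clK UE]] := sigmaK oU.
have mK n := closed_borel (clK n).
have [N muN] := tail_small mK e0.
exists (\big[setU/set0]_(i < N) K i), U; split=> //.
- by apply: bigsetU_compact => i _; exact: cK.
- by apply: closed_bigsetU => i _; exact: clK.
- by split=> //; rewrite UE -bigcup_mkord => x [i _ Kx]; exists i.
- by rewrite {1}UE.
Qed.

(** The complement of an open neighbourhood of A is closed but not compact; it
is cut with a compact set of almost full measure. *)
Let reg_setC (A : set (borel X)) : reg A -> reg (~` A).
Proof.
move=> [mA Areg]; split; first exact: measurableC.
move=> e e0; have e20 : 0 < e / 2 by rewrite divr_gt0.
have [K [U [cK clK oU [KA AU] muUK]]] := Areg _ e20.
have [_ /(_ _ e20)[L [V [cL clL oV [_ TV] muL]]]] := reg_open openT.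
have mU := open_borel oU; have mV := open_borel oV.
have mK := closed_borel clK; have mL := closed_borel clL.
exists (L `&` ~` U), (~` K); split.
- by apply: compact_closedI => //; rewrite closedC.
- by apply: closedI => //; rewrite closedC.
- by rewrite openC.
- by split=> [x [_ nUx] /AU|x nAx /KA].
apply: (@le_trans _ _ (mu ((V `\` L) `|` (U `\` K)))).
  apply: le_measure; rewrite ?inE.
  - by apply: measurableD; [exact: measurableC|apply: measurableI => //; exact: measurableC].
  - by apply: measurableU; exact: measurableD.
  move=> x [nKx nLU]; have [Ux|nUx] := pselect (U x); first by right.
  by left; split; [exact: TV|move=> Lx; exact: nLU].
by rewrite (splitr e) EFinD (le_trans (measureU2 _ _ _))// ?leeD//; exact: measurableD.
Qed.

(** The union of infinitely many compact sets need not be compact, but finitely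
many of them almost exhaust its measure. *)
Let reg_bigcup (A : nat -> set (borel X)) : (forall n, reg (A n)) -> reg (\bigcup_n A n).
Proof.
move=> Areg; have mA n : measurable (A n) by case: (Areg n).
split; first exact: bigcupT_measurable.
move=> e e0; have e20 : 0 < e / 2 by rewrite divr_gt0.
pose dl n : R := (e / 2) / (2 ^ n.+1)%:R.
have dl0 n : 0 < dl n by rewrite !divr_gt0// ltr0n expn_gt0.
have /choice[KU KUP] : forall n, exists KU : set X * set X,
    [/\ compact KU.1, closed KU.1, open KU.2,
    KU.1 `<=` A n /\ A n `<=` KU.2 & (mu (KU.2 `\` KU.1) <= (dl n)%:E)%E].
  by move=> n; have [_ /(_ _ (dl0 n))[K [U KUP]]] := Areg n; exists (K, U).
have mK n : measurable ((KU n).1 : set (borel X)) by have [_ /closed_borel] := KUP n.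
have mU n : measurable ((KU n).2 : set (borel X)) by have [_ _ /open_borel] := KUP n.
have [N muN] := tail_small mK e20.
exists (\big[setU/set0]_(i < N) (KU i).1), (\bigcup_n (KU n).2); split.
- by apply: bigsetU_compact => i _; have [] := KUP i.
- by apply: closed_bigsetU => i _; have [] := KUP i.
- by apply: bigcup_open => n _; have [] := KUP n.
- split.
    rewrite -(bigcup_mkord N (fun i => (KU i).1)) => x [i _ Kx].
    by exists i => //; have [_ _ _ [KA _] _] := KUP i; exact: KA.
  by apply: subset_bigcup => n _; have [_ _ _ [_ +] _] := KUP n.
pose D n := (KU n).2 `\` (KU n).1.
have mD n : measurable (D n : set (borel X)) by exact: measurableD.
have mKN : measurable (\big[setU/set0]_(i < N) (KU i).1 : set (borel X)).
  exact: bigsetU_measurable.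
apply: (@le_trans _ _ (mu ((\bigcup_n (KU n).1 `\`
    \big[setU/set0]_(i < N) (KU i).1) `|` \bigcup_n D n))).
  apply: le_measure; rewrite ?inE.
  - by apply: measurableD => //; exact: bigcupT_measurable.
  - apply: measurableU; last exact: bigcupT_measurable.
    by apply: measurableD => //; exact: bigcupT_measurable.
  move=> x [[n _ Ux] nKx]; have [Kx|nKnx] := pselect ((KU n).1 x).
    by left; split=> //; exists n.
  by right; exists n.
rewrite (splitr e) EFinD; apply: le_trans (measureU2 _ _ _) _.
- by apply: measurableD => //; exact: bigcupT_measurable.
- exact: bigcupT_measurable.
apply: leeD => //.
have mDU : measurable (\bigcup_n D n : set (borel X)) by exact: bigcupT_measurable.
apply: le_trans (@measure_sigma_subadditive _ _ _ mu _ _ mD mDU (@subset_refl _ _)) _.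
apply: le_trans (@epsilon_trick0 R (e / 2) xpredT (ltW e20)).
by apply: lee_nneseries => [n _ _|n _]; [exact: measure_ge0|have [] := KUP n].
Qed.

(** The sets that can be approximated by compact sets from inside and by open
sets from outside form a sigma-algebra containing the open sets. *)
Theorem sigma_compact_regular : compact_regular mu.
Proof.
suff: @measurable _ (borel X) `<=` reg.
  move=> sub A e /sub[_ Areg] /Areg[K [U [cK clK oU KAU muUK]]].
  by exists K, U; split=> //; exact: closed_borel.
apply: smallest_sub; last by move=> U; exact: reg_open.
split.
- exact/reg_open/open0.
- by move=> A /reg_setC; rewrite setTD.
- exact: reg_bigcup.
Qed.

End regularity.

Section closed_subspace.
Context (R : realType) (d : nat) (X : set 'rV[R]_d) (X0 : X !=set0).

Let pval (x : pointed_sub X0) : 'rV[R]_d := set_val (x : set_type X).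

Let pvalP x : X (pval x).
Proof. by case: x => z Xz; exact: (set_mem Xz). Qed.

Let open_subP (U : set (pointed_sub X0)) :
  open U <-> exists2 V : set 'rV[R]_d, open V & pval @^-1` V = U.
Proof. by []. Qed.

Let rat_ball (i : 'rV[rat]_d * nat) : set 'rV[R]_d :=
  ball (map_mx ratr i.1 : 'rV[R]_d) (i.2.+1%:R^-1).

Let rat_ball_base (V : set 'rV[R]_d) x : open V -> V x ->
  exists i, rat_ball i x /\ rat_ball i `<=` V.
Proof.
move=> oV Vx; have /nbhs_ballP[e /= e0 eV] : nbhs x V by exact: open_nbhs_nbhs.
pose n := Num.bound (2 / e).
have ne : n.+1%:R^-1 + n.+1%:R^-1 <= e.
  have ge0 : 0 <= 2 / e by rewrite divr_ge0// ltW.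
  have := ltW (archi_boundP ge0); rewrite -/n ler_pdivrMr// => ne.
  rewrite (_ : _ + _ = 2 / n.+1%:R); last by ring.
  rewrite ler_pdivrMr// mulrC (le_trans ne)// ler_wpM2r ?ltW//.
  by rewrite ltr_nat.
have n0 : (0 : R) < n.+1%:R^-1 by rewrite invr_gt0.
have /choice[q qx] : forall j, exists q : rat, `|x ord0 j - ratr q| < n.+1%:R^-1.
  move=> j; have [|q] := @rat_in_itvoo R (x ord0 j - n.+1%:R^-1) (x ord0 j + n.+1%:R^-1).
    by rewrite ltrBlDr -addrA ltrDl addr_gt0.
  by rewrite in_itv /= => xq; exists q; rewrite ltr_distlC.
have qball : ball x n.+1%:R^-1 (map_mx ratr (\row_j q j) : 'rV[R]_d).
  split=> // i j; rewrite !mxE (ord1 i).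
  exact: qx.
exists (\row_j q j, n); split; first exact: ball_sym.
move=> y /= qy; apply: eV; apply: le_ball ne _ _.
exact: ball_triangle qball qy.
Qed.

Lemma countable_base_sub : countable_base (pointed_sub X0).
Proof.
exists (fun k => if unpickle k is Some i then pval @^-1` (rat_ball i) else set0).
split=> [k|U x].
  case: unpickle => [i|]; last exact: open0.
  apply/open_subP; exists (rat_ball i) => //.
  exact: ball_open.
move=> /open_subP[V oV <-] Vx; have [i [ix iV]] := rat_ball_base oV Vx.
by exists (pickle i); rewrite pickleK; split=> // y /iV.
Qed.

Hypothesis cX : closed X.

(** A filter on the subspace is pushed to the ambient space; its cluster points
lie in X because X is closed. *)
Let compact_sub (K : set 'rV[R]_d) : compact K -> closed K -> compact (pval @^-1` K).
Proof.
move=> cK clK F FF FK.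
have FpK : (pval @ F) (K `&` X).
  by apply: (@filterS _ F _ (pval @^-1` K)) => // x Kx; split=> //; exact: pvalP.
have cKX : compact (K `&` X) by exact: compact_closedI.
have [p [[Kp Xp] clp]] := cKX (pval @ F) _ FpK.
exists (exist _ p (mem_set Xp)); split; first by [].
move=> A B FA.
rewrite nbhsE => -[U [oU Up] UB].
move: oU => /open_subP[V oV VU].
have pA : (pval @ F) (pval @` A).
  by apply: (@filterS _ F _ A) => // y Ay; exists y.
have pV : nbhs p V by apply: open_nbhs_nbhs; split=> //; move: Up; rewrite -VU.
have [_ [[y Ay <-] Vy]] := clp _ _ pA pV.
by exists y; split=> //; apply: UB; rewrite -VU.
Qed.

(** An open set is exhausted by the closed sets of points at distance at least
1 / (n + 1) from its complement, cut with closed balls. *)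
Lemma sigma_compact_opens_sub : sigma_compact_opens (pointed_sub X0).
Proof.
move=> U /open_subP[V oV VU].
pose K n : set 'rV[R]_d := ~` (\bigcup_(y in ~` V) ball y n.+1%:R^-1) `&`
  [set x | `|x| <= n%:R].
have n0 n : (0 : R) < n.+1%:R^-1 by rewrite invr_gt0.
have clK n : closed (K n).
  apply: closedI; first by rewrite closedC; apply: bigcup_open => y _; exact: ball_open.
  rewrite (_ : [set _ | _] = closed_ball_ Num.norm (0 : 'rV[R]_d) n%:R).
    exact: closed_closed_ball_.
  by apply/seteqP; split=> x; rewrite /closed_ball_ /= sub0r normrN.
have cK n : compact (K n).
  apply: bounded_closed_compact => //.
  exists n%:R; split; first exact: num_real.
  by move=> y ny x [_ xn]; rewrite /= (le_trans xn)// ltW.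
exists (fun n => pval @^-1` (K n)); split.
- by move=> n; exact: compact_sub.
- move=> n; rewrite -openC; apply/open_subP; exists (~` K n) => //.
  by rewrite openC.
rewrite -VU -preimage_bigcup; congr (_ @^-1` _).
apply/seteqP; split=> x.
  move=> Vx; have /nbhs_ballP[e /= e0 eV] : nbhs x V by exact: open_nbhs_nbhs.
  pose n := maxn (Num.bound e^-1) (Num.bound `|x|).
  have ne : n.+1%:R^-1 <= e.
    have ge0 : 0 <= e^-1 by rewrite invr_ge0 ltW.
    rewrite -[leRHS]invrK lef_pV2 ?posrE ?invr_gt0//.
    apply: le_trans (ltW (archi_boundP ge0)) _.
    by rewrite ler_nat leqW// leq_maxl.
  exists n => //; split.
    move=> [y nVy yx]; apply: nVy; apply: eV; apply: le_ball ne _ _.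
    exact: ball_sym.
  apply: le_trans (ltW (archi_boundP (normr_ge0 x))) _.
  by rewrite ler_nat leq_maxr.
move=> [n _ [nV _]]; apply: contrapT => nVx; apply: nV.
by exists x => //; exact: ballxx.
Qed.

End closed_subspace.

(** * Couplings *)

(** Monotone convergence for a decreasing sequence, stated with f above the
pointwise infimum so that the infimum itself never has to be named. *)
Lemma unit_decreasing_integral d (T : measurableType d) (R : realType)
    (mu : probability T R) (u : nat -> T -> R) (f : T -> R) (c : R) :
  (forall n, measurable_fun [set: T] (u n)) -> (forall n x, 0 <= u n x <= 1) ->
  (forall n x, u n.+1 x <= u n x) -> (forall n, c <= \int[mu]_x u n x) ->
  bmeas f -> (forall x a, (forall n, a <= u n x) -> a <= f x) ->
  c <= \int[mu]_x f x.
Proof.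
move=> mu_ u01 udec cu bf uf; pose h := pointwise_limsup u.
have bh : bmeas h.
  by apply: bmeas_unit; [exact: measurable_limsup|exact: limsup_unit].
have ulb x : has_lbound (range (u ^~ x)) by exists 0 => _ [n _ <-]; have /andP[] := u01 n x.
have ucvg x : cvgn (u ^~ x).
  apply: nonincreasing_is_cvgn => //.
  by apply/nonincreasing_seqP => n; exact: udec.
have hE x : h x = limn (u ^~ x) by exact: cvg_limn_supE.
have udown x n m : (n <= m)%N -> u m x <= u n x.
  move=> /subnKC <-; elim: (m - n)%N => [|k IH]; first by rewrite addn0.
  by rewrite addnS; exact: le_trans (udec _ _) IH.
have h_le x n : h x <= u n x.
  by rewrite hE; apply: nonincreasing_cvgn_ge => // a b ab; exact: udown.
apply: (@le_trans _ _ (\int[mu]_x h x)); last first.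
  by apply: le_bRintegral => // x; apply: uf => n; exact: h_le.
have bu n : bmeas (u n) by exact: bmeas_unit.
have H1 n : measurable_fun [set: T] (fun x => (u n x)%:E).
  by apply/measurable_EFinP; case: (bu n).
have H2 : measurable_fun [set: T] (fun x => (h x)%:E).
  by apply/measurable_EFinP; case: bh.
have H3 : {ae mu, forall x, [set: T] x -> (fun n => (u n x)%:E) @ \oo --> (h x)%:E}.
  apply: aeW => x _; apply: cvg_EFin; first exact: nearW.
  by rewrite hE; exact: ucvg.
have H4 : mu.-integrable [set: T] (cst 1%E).
  exact: (bmeas_integrable mu (bmeas_cst T 1)).
have H5 : {ae mu, forall x n, [set: T] x -> (`|(u n x)%:E| <= cst 1%E x)%E}.
  by apply: aeW => x n _; rewrite /= lee_fin; have /andP[? ?] := u01 n x; rewrite ger0_norm.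
have [_ _ cvg_int] := dominated_convergence measurableT H1 H2 H3 H4 H5.
rewrite -lee_fin EFin_Rintegral// -(cvg_lim _ cvg_int)//.
apply: lime_ge; first by apply/cvg_ex; eexists; exact: cvg_int.
by apply: nearW => n; rewrite /= -EFin_Rintegral// lee_fin.
Qed.

Lemma bounded_fun_norm_le (T : Type) (R : realType) (f : T -> R) :
  bounded_fun f -> exists M, forall x, `|f x| <= M.
Proof.
by move=> [M [_ fM]]; exists (M + 1) => x; apply: fM => //; rewrite ltrDl.
Qed.

Section continuous_borel.
Context (R : realType).

Lemma continuous_borel (X Y : ptopologicalType) (f : X -> Y) :
  continuous f -> measurable_fun [set: borel X] (f : borel X -> borel Y).
Proof.
move=> cf; apply: (@measurability _ _ (borel X) (borel Y) setT f open) => // _ [V oV <-].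
by rewrite setTI; apply: open_borel; move/continuousP : cf; exact.
Qed.

Lemma continuous_bmeas (Z : ptopologicalType) (f : Z -> R) :
  Cb f -> bmeas (f : borel Z -> R).
Proof.
move=> [cf /bounded_fun_norm_le fM]; split=> //.
apply: (measurability _ (RGenOInfty.measurableE R)) => _ [_ [a ->] <-].
rewrite setTI; apply: open_borel; move/continuousP : cf; apply.
exact: interval_open.
Qed.

Lemma BbP (Z : ptopologicalType) (f : Z -> R) : Bb f <-> bmeas (f : borel Z -> R).
Proof.
split=> [[mf /bounded_fun_norm_le fM]|bf]; first by split.
by split; [case: bf|exact: bmeas_bounded bf].
Qed.

End continuous_borel.

Section couplings.
Context (X Y : ptopologicalType) (R : realType).
Variables (mu : probability (borel X) R) (nu : probability (borel Y) R).
Let Omega : ptopologicalType := (X * Y)%type.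

Definition coupling (m : probability (borel Omega) R) :=
  (forall A : set (borel X), measurable A -> m (A `*` setT) = mu A) /\
  (forall B : set (borel Y), measurable B -> m (setT `*` B) = nu B).

Let mfst : measurable_fun [set: borel Omega] (fst : borel Omega -> borel X).
Proof. by apply: (@continuous_borel Omega X) => z; exact: cvg_fst. Qed.

Let msnd : measurable_fun [set: borel Omega] (snd : borel Omega -> borel Y).
Proof. by apply: (@continuous_borel Omega Y) => z; exact: cvg_snd. Qed.

Lemma measurable_rect (A : set (borel X)) (B : set (borel Y)) :
  measurable A -> measurable B -> measurable (A `*` B : set (borel Omega)).
Proof.
move=> mA mB.
rewrite (_ : A `*` B = (fst @^-1` A) `&` (snd @^-1` B)); last by [].
apply: measurableI; rewrite -[X in measurable X]setTI.
  exact: mfst.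
exact: msnd.
Qed.

Lemma bmeas_fst (h : borel X -> R) : bmeas h -> bmeas (fun w : borel Omega => h w.1).
Proof.
move=> [mh [M hM]]; split; last by exists M => w; exact: hM.
exact: (measurableT_comp mh mfst).
Qed.

Lemma bmeas_snd (g : borel Y -> R) : bmeas g -> bmeas (fun w : borel Omega => g w.2).
Proof.
move=> [mg [M gM]]; split; last by exists M => w; exact: gM.
exact: (measurableT_comp mg msnd).
Qed.

Lemma bmeas_oplus (h : borel X -> R) (g : borel Y -> R) : bmeas h -> bmeas g ->
  bmeas (oplus h g : borel Omega -> R).
Proof. by move=> bh bg; apply: bmeasD; [exact: bmeas_fst|exact: bmeas_snd]. Qed.

Variable m : probability (borel Omega) R.
Hypothesis coupling_m : coupling m.

Lemma coupling_fst (h : borel X -> R) : bmeas h ->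
  \int[m]_w h w.1 = \int[mu]_x h x.
Proof.
move=> bh; congr fine.
have bh1 := bmeas_integrable m (bmeas_fst bh).
have mh : measurable_fun [set: borel X] (EFin \o h).
  by apply/measurable_EFinP; case: bh.
rewrite -[LHS](@integral_pushforward _ _ _ _ _ _ mfst m setT _ mh)//.
by apply: eq_measure_integral => A mA _;
  apply: etrans (coupling_m.1 _ mA); congr (m _); rewrite setXT.
Qed.

Lemma coupling_snd (g : borel Y -> R) : bmeas g ->
  \int[m]_w g w.2 = \int[nu]_y g y.
Proof.
move=> bg; congr fine.
have bg2 := bmeas_integrable m (bmeas_snd bg).
have mg : measurable_fun [set: borel Y] (EFin \o g).
  by apply/measurable_EFinP; case: bg.
rewrite -[LHS](@integral_pushforward _ _ _ _ _ _ msnd m setT _ mg)//.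
by apply: eq_measure_integral => A mA _;
  apply: etrans (coupling_m.2 _ mA); congr (m _); rewrite setTX.
Qed.

Lemma coupling_oplus (h : borel X -> R) (g : borel Y -> R) : bmeas h -> bmeas g ->
  \int[m]_w oplus h g w = \int[mu]_x h x + \int[nu]_y g y.
Proof.
move=> bh bg; rewrite bRintegralD ?coupling_fst ?coupling_snd//.
- exact: bmeas_fst.
- exact: bmeas_snd.
Qed.

(** The functional of the coupling m is its integral; its norm is at most 1. *)
Lemma coupling_Qot : Qot_measures mu nu m.
Proof.
exists (fun f => \int[m]_w f w); last first.
  by split; [apply coupling_m|apply coupling_m|
    move=> f /continuous_bmeas bf; exact: EFin_Rintegral].
split.
- split; last by move=> f _ f0; exact: Rintegral_ge0.
  split.
    move=> a f g /continuous_bmeas bf /continuous_bmeas bg.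
    by rewrite bRintegralD ?bRintegralZ//; exact: bmeasZ.
  exists 1 => f /continuous_bmeas bf; rewrite mul1r.
  have [mf [M fM]] := bf.
  apply: le_trans (le_normr_Rintegral measurableT (bmeas_integrable m bf)) _.
  rewrite -[leRHS](bRintegral_cst m).
  apply: le_bRintegral; [exact: bmeas_norm|exact: bmeas_cst|].
  move=> z; apply: ub_le_sup; last by exists z.
  by exists M => _ [w _ <-].
- exact: bRintegral_cst.
- move=> _ [h [g [ch cg [h0 g0] ->]]].
  have bh := continuous_bmeas ch; have bg := continuous_bmeas cg.
  by rewrite coupling_oplus// /Rintegral h0 g0 addr0.
Qed.

End couplings.

Lemma Qot_coupling (X Y : ptopologicalType) (R : realType)
    (mu : probability (borel X) R) (nu : probability (borel Y) R) m :
  Qot_measures mu nu m -> coupling mu nu m.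
Proof. by move=> [eta _ []]. Qed.

(** * Functions simple over rectangles, and the dual functional *)

Section rectangle_simple.
Context (X Y : ptopologicalType) (R : realType).
Let Omega : ptopologicalType := (X * Y)%type.
Implicit Types f g : Omega -> R.

(** The function factors through a finite measurable partition of each side,
a form that is visibly stable under all pointwise operations. *)
Definition rsimple f := exists (I J : finType) (p : X -> I) (q : Y -> J) (F : I -> J -> R),
  [/\ forall i, measurable (p @^-1` [set i] : set (borel X)),
      forall j, measurable (q @^-1` [set j] : set (borel Y)) &
      forall w, f w = F (p w.1) (q w.2)].

Lemma rsimple_op2 (op : R -> R -> R) f g : rsimple f -> rsimple g ->
  rsimple (fun w => op (f w) (g w)).
Proof.
move=> [I [J [p [q [F [mp mq fE]]]]]] [I' [J' [p' [q' [F' [mp' mq' gE]]]]]].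
exists (I * I')%type, (J * J')%type, (fun x => (p x, p' x)), (fun y => (q y, q' y)).
exists (fun i j => op (F i.1 j.1) (F' i.2 j.2)); split.
- move=> [i i']; rewrite (_ : _ @^-1` _ = p @^-1` [set i] `&` p' @^-1` [set i']).
    exact: measurableI.
  by apply/seteqP; split=> x /= [-> ->].
- move=> [j j']; rewrite (_ : _ @^-1` _ = q @^-1` [set j] `&` q' @^-1` [set j']).
    exact: measurableI.
  by apply/seteqP; split=> x /= [-> ->].
- by move=> w; rewrite fE gE.
Qed.

Lemma rsimple_rect (A : set (borel X)) (B : set (borel Y)) a b :
  measurable A -> measurable B ->
  rsimple (fun w => if (w.1 \in A) && (w.2 \in B) then a else b).
Proof.
have mb d (T : measurableType d) (C : set T) i : measurable C ->
    measurable ((fun x => x \in C) @^-1` [set i]).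
  move=> mC; case: i.
    by rewrite (_ : _ @^-1` _ = C)//; apply/seteqP; split=> x /=; [exact: set_mem|exact: mem_set].
  rewrite (_ : _ @^-1` _ = ~` C); first exact: measurableC.
  by apply/seteqP; split=> x /=; [move=> xC /mem_set; rewrite xC|exact: memNset].
move=> mA mB; exists bool, bool, (fun x => x \in A), (fun y => y \in B).
by exists (fun i j => if i && j then a else b); split=> // i; exact: mb.
Qed.

Lemma rsimple_cst a : rsimple (cst a).
Proof.
have := @rsimple_rect setT setT a a measurableT measurableT.
by congr rsimple; apply/funext => w; rewrite if_same.
Qed.

(** Summing over the finitely many cells writes the function as a linear
combination of indicators of rectangles. *)
Lemma rsimple_ind (P : (Omega -> R) -> Prop) :
  P (cst 0) ->
  (forall (A : set (borel X)) (B : set (borel Y)), measurable A -> measurable B ->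
    P (\1_(A `*` B))) ->
  (forall a f g, P f -> P g -> P (fun w => a * f w + g w)) ->
  forall f, rsimple f -> P f.
Proof.
move=> P0 P1 PD f [I [J [p [q [F [mp mq fE]]]]]].
pose D k : set Omega := (p @^-1` [set k.1]) `*` (q @^-1` [set k.2]).
have Psum (s : seq (I * J)) : P (fun w => \sum_(k <- s) F k.1 k.2 * \1_(D k) w).
  elim: s => [|k s IH].
    by rewrite (_ : (fun _ => _) = cst 0)//; apply/funext => w; rewrite big_nil.
  rewrite (_ : (fun _ => _) = fun w => F k.1 k.2 * \1_(D k) w +
      \sum_(k <- s) F k.1 k.2 * \1_(D k) w); first by apply: PD => //; exact: P1.
  by apply/funext => w; rewrite big_cons.
rewrite (_ : f = fun w => \sum_(k <- index_enum _) F k.1 k.2 * \1_(D k) w) //.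
apply/funext => w; rewrite fE (bigD1 (p w.1, q w.2))//= big1 ?addr0.
  by rewrite indicE mem_set ?mulr1.
move=> k /eqP kw; rewrite indicE memNset ?mulr0// => -[/= pk qk].
by apply: kw; rewrite pk qk -surjective_pairing.
Qed.

Lemma rsimple_bmeas f : rsimple f -> bmeas (f : borel Omega -> R).
Proof.
apply: rsimple_ind => [|A B mA mB|a g h bg bh].
- exact: bmeas_cst.
- by apply: bmeas_indic; exact: measurable_rect.
- by apply: bmeasD => //; exact: bmeasZ.
Qed.

End rectangle_simple.

Section dual_functional.
Context (X Y : ptopologicalType) (R : realType).
Variables (mu : probability (borel X) R) (nu : probability (borel Y) R).
Let Omega : ptopologicalType := (X * Y)%type.

Definition hypograph (f : Omega -> R) : set (borel X * borel Y * R) :=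
  [set w | w.2 <= f w.1].

(** If - h(x) <= g(y) for all x and y, one integrates in y and then in x; this
proves the inequality without the help of a product measure. *)
Lemma cost_ge0 (h : borel X -> R) (g : borel Y -> R) : bmeas h -> bmeas g ->
  (forall x y, 0 <= h x + g y) -> 0 <= cost mu nu (h, g).
Proof.
move=> bh bg hg; rewrite /cost /=; set b := \int[nu]_y g y.
suff hb x : - b <= h x.
  have := le_bRintegral mu (bmeas_cst _ (- b)) bh hb.
  by rewrite bRintegral_cst; lra.
have := @le_bRintegral _ _ _ nu _ _ (bmeas_cst _ (- h x)) bg.
rewrite bRintegral_cst -/b => /(_ _); have hxg y : - h x <= g y by have := hg x y; lra.
by move=> /(_ hxg); lra.
Qed.

(** Moving the constant inf h from h to g makes both functions nonnegative,
because f is; cutting them at 1 keeps their sum above f, because f is at most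
1, and only lowers the cost. *)
Lemma unit_pair_reduction (f : Omega -> R) (h : borel X -> R) (g : borel Y -> R) :
  (forall w, 0 <= f w <= 1) -> bmeas h -> bmeas g ->
  (forall w, f w <= h w.1 + g w.2) ->
  exists p, hedges mu nu (hypograph f) (cost mu nu (h, g)) p.
Proof.
move=> f01 bh bg fhg; pose a := inf (range h).
have hlb : has_inf (range h).
  split; first by exists (h point), point.
  have [_ [M hM]] := bh; exists (- M) => _ [x _ <-].
  by have := hM x; rewrite ler_norml => /andP[].
have h0 x : 0 <= h x - a by rewrite subr_ge0; apply: (inf_lbound hlb.2); exists x.
have g0 y : 0 <= g y + a.
  rewrite -lerBlDl sub0r; apply: lb_le_inf hlb.1 _ => _ [x _ <-].
  by have := fhg (x, y); have /andP[+ _] := f01 (x, y) => /=; lra.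
pose h1 x := Num.min (h x - a) 1; pose g1 y := Num.min (g y + a) 1.
have bha : bmeas (fun x => h x - a) by apply: bmeasB => //; exact: bmeas_cst.
have bga : bmeas (fun y => g y + a) by apply: bmeasD => //; exact: bmeas_cst.
have h101 x : 0 <= h1 x <= 1 by rewrite /h1 le_min h0 ler01 ge_min lexx orbT.
have g101 x : 0 <= g1 x <= 1 by rewrite /g1 le_min g0 ler01 ge_min lexx orbT.
have mh1 : measurable_fun [set: borel X] h1.
  by apply: measurable_minr => //; case: bha.
have mg1 : measurable_fun [set: borel Y] g1.
  by apply: measurable_minr => //; case: bga.
exists (h1, g1); split; first by split.
- move=> [[x y] t] /= tf; apply: le_trans tf _.
  have := fhg (x, y); have /andP[_ +] := f01 (x, y) => /=.
  have := h0 x; have := g0 y; rewrite /h1 /g1.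
  by rewrite /Num.min; case: ifPn => _; case: ifPn => _; lra.
- apply: (@le_trans _ _ (cost mu nu (fun x => h x - a, fun y => g y + a))).
    apply: lerD; apply: le_bRintegral => //; try exact: bmeas_unit;
      by move=> x; rewrite /= /h1 /g1 ge_min lexx.
  rewrite /cost /= (bRintegralB _ bh (bmeas_cst _ a)) (bRintegralD _ bg (bmeas_cst _ a)).
  by rewrite !bRintegral_cst; lra.
Qed.

Hypotheses (mu_reg : compact_regular mu) (nu_reg : compact_regular nu).
Hypothesis borel_rect : forall A : set Omega, open A ->
  <<s @rectangles _ (borel X) _ (borel Y) >> A.

(** If - 1 were in the cone K, some multiple of f k - c would be at most a sum
of cost at most 0, minus 1, and dividing by the multiplier would give a pair
dominating f k at cost at most c. *)
Theorem unhedged_coupling (f : nat -> Omega -> R) (c : R) :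
  (forall k, rsimple (f k)) -> (forall k w, 0 <= f k w <= 1) ->
  (forall k w, f k.+1 w <= f k w) ->
  (forall k, ~ exists p, hedges mu nu (hypograph (f k)) c p) ->
  exists2 m, coupling mu nu m & forall k, c <= \int[m]_w f k w.
Proof.
move=> sf f01 fdec nohedge.
have fmono k l w : (k <= l)%N -> f l w <= f k w.
  move=> /subnKC <-; elim: (l - k)%N => [|j IH]; first by rewrite addn0.
  by rewrite addnS; exact: le_trans (fdec _ _) IH.
(* the functional lives on all functions, and is used on the bounded ones *)
pose V : lmodType R := (Omega -> R^o).
pose e : V := cst 1.
pose K : set V := [set v | exists (h : borel X -> R) (g : borel Y -> R) l k,
  [/\ bmeas h, bmeas g, cost mu nu (h, g) <= 0, 0 <= l &
      forall w, l * (f k w - c) <= v w + h w.1 + g w.2]].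
have cost0 : cost mu nu (cst 0, cst 0) = 0 by rewrite /cost /= !bRintegral_cst addr0.
have K_ge0 (v : V) : (forall w, 0 <= v w) -> K v.
  move=> v0; exists (cst 0), (cst 0), 0, 0%N; split=> //; try exact: bmeas_cst.
    by rewrite cost0.
  by move=> w; rewrite mul0r !addr0.
have coneK : convex_cone K.
  split; first exact: K_ge0.
    move=> a v a0 [h [g [l [k [bh bg hg0 l0 vE]]]]].
    exists (fun x => a * h x), (fun y => a * g y), (a * l), k; split.
    - exact: bmeasZ.
    - exact: bmeasZ.
    - by rewrite /cost /= !bRintegralZ// -mulrDr mulr_ge0_le0.
    - exact: mulr_ge0.
    - by move=> w; rewrite -!mulrA -!mulrDr; apply: ler_wpM2l => //; rewrite vE.
  move=> v v' [h [g [l [k [bh bg hg0 l0 vE]]]]] [h' [g' [l' [k' [bh' bg' hg'0 l'0 v'E]]]]].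
  exists (fun x => h x + h' x), (fun y => g y + g' y), (l + l'), (maxn k k'); split.
  - exact: bmeasD.
  - exact: bmeasD.
  - by rewrite /cost /= !bRintegralD//; move: hg0 hg'0; rewrite /cost /=; lra.
  - exact: addr_ge0.
  - move=> w; rewrite mulrDl.
    have H1 : l * (f (maxn k k') w - c) <= l * (f k w - c).
      by apply: ler_wpM2l => //; rewrite lerD2r fmono// leq_maxl.
    have H2 : l' * (f (maxn k k') w - c) <= l' * (f k' w - c).
      by apply: ler_wpM2l => //; rewrite lerD2r fmono// leq_maxr.
    rewrite [X in _ <= X + _ + _](_ : _ = v w + v' w)//.
    by have := vE w; have := v'E w; lra.
have properK : ~ K (- e).
  move=> [h [g [l [k [bh bg hg0 l0 eE]]]]].
  have {}eE w : l * (f k w - c) <= - 1 + h w.1 + g w.2 by exact: eE.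
  (* for l = 0 the pair h, g dominates 1 at cost at most 0 *)
  have [l00|l_neq0] := eqVneq l 0.
    have b1 : bmeas (fun x => h x - 1) by apply: bmeasB => //; exact: bmeas_cst.
    have := cost_ge0 b1 bg; rewrite /cost /= (bRintegralB _ bh (bmeas_cst _ 1)) bRintegral_cst.
    move=> /(_ _); have hg w : 0 <= h w.1 - 1 + g w.2.
      by have := eE w; rewrite l00 mul0r; lra.
    by move=> /(_ (fun x y => hg (x, y))); move: hg0; rewrite /cost /=; lra.
  have l_gt0 : 0 < l by rewrite lt_neqAle eq_sym l_neq0.
  have b1 : bmeas (fun x => l^-1 * (h x - 1) + c).
    by apply: bmeasD; [apply/bmeasZ/bmeasB => //; exact: bmeas_cst|exact: bmeas_cst].
  have b2 : bmeas (fun y => l^-1 * g y) by exact: bmeasZ.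
  apply: (nohedge k); have [|p [up cov cp]] := unit_pair_reduction (f01 k) b1 b2.
    move=> w; rewrite addrAC -mulrDr -lerBlDr mulrC ler_pdivlMr// mulrC.
    by have := eE w; lra.
  exists p; split=> //; apply: le_trans cp _; rewrite /cost /=.
  rewrite (bRintegralD _ (bmeasZ _ (bmeasB bh (bmeas_cst _ 1))) (bmeas_cst _ c)).
  rewrite !bRintegralZ//; last by apply: bmeasB => //; exact: bmeas_cst.
  rewrite (bRintegralB _ bh (bmeas_cst _ 1)) !bRintegral_cst.
  rewrite addrAC -mulrDr -lerBrDr subrr pmulr_rle0 ?invr_gt0//.
  by move: hg0; rewrite /cost /=; lra.
have [eta [etaD etaZ eta_pos eta1]] := cone_functional coneK (K_ge0 e (fun=> ler01)) properK.
have dom (v : V) M : (forall w, `|v w| <= M) -> dominated K e v.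
  move=> vM; exists M; split; apply: K_ge0 => w.
    rewrite [X in 0 <= X](_ : _ = M * 1 - v w)//.
    by have := vM w; rewrite ler_norml => /andP[]; lra.
  rewrite [X in 0 <= X](_ : _ = M * 1 + v w)//.
  by have := vM w; rewrite ler_norml => /andP[]; lra.
have bdom (f' : borel Omega -> R) : bmeas f' -> dominated K e (f' : V).
  by move=> [_ [M fM]]; exact: dom fM.
have domZ := dominatedZ coneK.
have dome : dominated K e e.
  by apply: (dom e 1) => w; rewrite normr1.
have etaB (v : V) a : dominated K e v -> eta (a *: e - v) = a - eta v.
  move=> dv; rewrite -scaleN1r etaD; last 2 first.
  - exact: domZ.
  - exact: domZ.
  by rewrite !etaZ// eta1 mulr1 mulN1r.
have eta_le (h : borel X -> R) (g : borel Y -> R) : bmeas h -> bmeas g ->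
    eta (oplus h g : V) <= cost mu nu (h, g).
  move=> bh bg; set b := cost mu nu (h, g).
  have dhg : dominated K e (oplus h g : V) by apply: bdom; exact: bmeas_oplus.
  rewrite -subr_ge0 -etaB//; apply: eta_pos.
    by rewrite -scaleN1r; apply: (dominatedD coneK); apply: (domZ).
  exists h, (fun y => g y - b), 0, 0%N; split=> //.
  - by apply: bmeasB => //; exact: bmeas_cst.
  - rewrite /cost /= (bRintegralB _ bg (bmeas_cst _ b)) bRintegral_cst.
    by rewrite /b /cost /=; lra.
  - move=> w; rewrite mul0r [X in _ <= X + _ + _](_ : _ = b * 1 - (h w.1 + g w.2))//.
    by lra.
have etaE (h : borel X -> R) (g : borel Y -> R) : bmeas h -> bmeas g ->
    eta (oplus h g : V) = cost mu nu (h, g).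
  move=> bh bg; apply/eqP; rewrite eq_le eta_le//=.
  have := eta_le _ _ (bmeasZ (-1) bh) (bmeasZ (-1) bg).
  rewrite (_ : oplus _ _ = -1 *: (oplus h g : V)); last first.
    by apply/funext => w; rewrite /oplus /= -mulrDr.
  rewrite etaZ; last by apply: bdom; exact: bmeas_oplus.
  by rewrite /cost /= !bRintegralZ//; lra.
pose eta_set (A : set Omega) : R := eta (\1_A : V).
have d1 (A : set Omega) : dominated K e (\1_A : V).
  by apply: (dom _ 1) => w; rewrite indicE; case: (_ \in _); rewrite ?normr1 ?normr0.
have es_ge0 A : 0 <= eta_set A.
  by apply: eta_pos => //; apply: K_ge0 => w; rewrite indicE.
have esU A B : A `&` B = set0 -> eta_set (A `|` B) = eta_set A + eta_set B.
  move=> AB; rewrite /eta_set -etaD//; congr eta; apply/funext => w.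
  have nAB : ~ (A `&` B) w by rewrite AB.
  rewrite -[RHS]/(\1_A w + \1_B w : R) !indicE in_setU.
  have [wA|nwA] := boolP (w \in A); last by rewrite /= add0r.
  rewrite (memNset (A := B)) ?addr0// => Bw; apply: nAB; split=> //; exact: set_mem.
have es_mu (A : set (borel X)) : measurable A -> (eta_set (A `*` setT))%:E = mu A.
  move=> mA; rewrite /eta_set (_ : \1_(_) = oplus \1_A (cst 0) :> V); last first.
    by apply/funext => w; rewrite /oplus /= !indicE in_setX in_setT andbT addr0.
  rewrite etaE; [|exact: bmeas_indic|exact: bmeas_cst].
  rewrite /cost /= bRintegral_cst addr0 EFin_Rintegral; last exact: bmeas_indic.
  by rewrite integral_indic// setIT.
have es_nu (B : set (borel Y)) : measurable B -> (eta_set (setT `*` B))%:E = nu B.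
  move=> mB; rewrite /eta_set (_ : \1_(_) = oplus (cst 0) \1_B :> V); last first.
    by apply/funext => w; rewrite /oplus /= !indicE in_setX in_setT add0r.
  rewrite etaE; [|exact: bmeas_cst|exact: bmeas_indic].
  rewrite /cost /= bRintegral_cst add0r EFin_Rintegral; last exact: bmeas_indic.
  by rewrite integral_indic// setIT.
have [m mE] := coupling_extension mu_reg nu_reg borel_rect es_ge0 esU es_mu es_nu.
exists m.
  split=> [A mA|B mB]; first by rewrite mE// es_mu.
  by rewrite mE// es_nu.
have eta_int (f' : Omega -> R) : rsimple f' ->
    bmeas (f' : borel Omega -> R) /\ eta (f' : V) = \int[m]_w f' w.
  move: f'; apply: rsimple_ind.
  - split; first exact: bmeas_cst.
    rewrite bRintegral_cst (_ : cst 0 = 0 *: e :> V) ?etaZ// ?mul0r//.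
    by rewrite scale0r.
  - move=> A B mA mB; have mAB := measurable_rect mA mB.
    split; first exact: bmeas_indic.
    apply: EFin_inj; rewrite -[LHS](mE _ _ mA mB) EFin_Rintegral; last exact: bmeas_indic.
    by rewrite integral_indic// setIT.
  - move=> a f1 f2 [bf1 e1] [bf2 e2]; split; first by apply: bmeasD => //; exact: bmeasZ.
    rewrite bRintegralD ?bRintegralZ//; last exact: bmeasZ.
    rewrite -e1 -e2 -etaZ; last exact: bdom.
    by rewrite -etaD//; [apply: domZ; exact: bdom|exact: bdom].
move=> k; have [bf <-] := eta_int _ (sf k).
rewrite -subr_ge0 -[- c]mulr1 -eta1 -etaZ// -etaD; last 2 first.
- exact: bdom.
- exact: domZ.
apply: eta_pos; first by apply: (dominatedD coneK); [exact: bdom|exact: domZ].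
exists (cst 0), (cst 0), 1, k; split; try exact: bmeas_cst.
- by rewrite cost0.
- exact: ler01.
- by move=> w; rewrite [X in _ <= X + _ + _](_ : _ = f k w + - c * 1)//= !addr0 mulr1 mul1r.
Qed.

End dual_functional.

(** * Duality for payoffs with values in the unit interval *)

Section strong_duality.
Context (X Y : ptopologicalType) (R : realType).
Variables (mu : probability (borel X) R) (nu : probability (borel Y) R).
Hypotheses (mu_reg : compact_regular mu) (nu_reg : compact_regular nu).
Let Omega : ptopologicalType := (X * Y)%type.
Local Notation space := (borel X * borel Y * R)%type.
Hypothesis borel_rect : forall A : set Omega, open A ->
  <<s @rectangles _ (borel X) _ (borel Y) >> A.

(** Hypographs are compared on heights 0 < t <= 1 only.  There the empty set
and the full set are the hypographs of 0 and 1, and a pair with values in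
[0, 1] has nothing to dominate at the other heights. *)
Let strip : set space := [set w | 0 < w.2 <= 1].

Let paving : set (set space) := [set A | exists f : Omega -> R,
  [/\ rsimple f, forall w, 0 <= f w <= 1 &
      forall w, strip w -> (A w <-> w.2 <= f w.1)]].

Let paving0 : paving set0.
Proof.
exists (cst 0); split=> [|w|w /andP[w0 _]]; first exact: rsimple_cst.
  by rewrite lexx ler01.
by split=> //=; rewrite leNgt w0.
Qed.

Let pavingT : paving setT.
Proof.
exists (cst 1); split=> [|w|w /andP[_ w1]]; first exact: rsimple_cst.
  by rewrite lexx ler01.
by split.
Qed.

Let pavingU A B : paving A -> paving B -> paving (A `|` B).
Proof.
move=> [f [sf f01 fA]] [g [sg g01 gB]]; exists (fun w => Num.max (f w) (g w)); split.
- exact: rsimple_op2.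
- by move=> w; have /andP[? ?] := f01 w; have /andP[? ?] := g01 w;
    rewrite le_max ge_max; apply/andP; split; [apply/orP; left|apply/andP].
- move=> w sw; rewrite le_max; split.
    by move=> [/(fA _ sw) ->//|/(gB _ sw) ->]; rewrite orbT.
  by move=> /orP[/(fA _ sw)|/(gB _ sw)]; [left|right].
Qed.

Let pavingI A B : paving A -> paving B -> paving (A `&` B).
Proof.
move=> [f [sf f01 fA]] [g [sg g01 gB]]; exists (fun w => Num.min (f w) (g w)); split.
- exact: rsimple_op2.
- by move=> w; have /andP[? ?] := f01 w; have /andP[? ?] := g01 w;
    rewrite le_min ge_min; apply/andP; split; [apply/andP|apply/orP; left].
- move=> w sw; rewrite le_min; split.
    by move=> [/(fA _ sw) -> /(gB _ sw) ->].
  by move=> /andP[/(fA _ sw) ? /(gB _ sw) ?].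
Qed.

Let unhedged (c : R) : set (set space) :=
  [set A | ~ exists p, hedges mu nu (A `&` strip) c p].

Let unhedged_up c A B : A `<=` B -> unhedged c A -> unhedged c B.
Proof.
move=> AB nA [p [up cov cp]]; apply: nA; exists p; split=> // w [Aw sw].
by apply: cov; split=> //; exact: AB.
Qed.

(** A failure at the union is a failure at some stage: otherwise the pairs of
all stages would have a common limit. *)
Let unhedged_cont c (A : nat -> set space) : (forall n, A n `<=` A n.+1) ->
  unhedged c (\bigcup_n A n) -> exists n, unhedged c (A n).
Proof.
move=> Aup nU; apply: contrapT => /forallNP nA; apply: nU.
have [|//|n|p pP] := @hedges_limit _ _ _ _ _ mu nu (fun n => A n `&` strip) (fun=> c).
- by move=> n; apply: setSI; exact: Aup.
- by apply: contrapT; exact: nA.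
exists p; have [up _ cp] := pP 0%N; split=> // w [[n _ Aw] sw].
by have [_ + _] := pP n; apply.
Qed.

Let step (A : set Omega) (a b : R) : set space :=
  [set w | w.2 <= if w.1 \in A then a else b].

Let stepC A a b : step (~` A) a b = step A b a.
Proof.
by apply/seteqP; split=> w; rewrite /step /= in_setC; case: (_ \in _).
Qed.

(** The sets A whose two-valued functions all have Suslin hypographs form a
sigma-algebra: complements exchange the two values, and a union of sets gives
a union or an intersection of hypographs according to the order of the values. *)
Let borel_step (A : set (borel Omega)) a b : measurable A ->
  0 <= a <= 1 -> 0 <= b <= 1 -> suslin paving (step A a b).
Proof.
move=> mA; move: a b.
pose good := [set A : set Omega | forall a b, 0 <= a <= 1 -> 0 <= b <= 1 ->
  suslin paving (step A a b)].
suff goodA : good A by move=> a b; exact: goodA.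
have good0 : good set0.
  move=> a b a01 b01; apply: suslin_base; exists (cst b); split=> //.
    exact: rsimple_cst.
  by move=> w _; rewrite /step /= in_set0.
have goodU (F : nat -> set Omega) : (forall n, good (F n)) -> good (\bigcup_n F n).
  move=> gF a b a01 b01; have [ba|ab] := leP b a.
    rewrite (_ : step _ a b = \bigcup_n step (F n) a b).
      by apply: suslin_bigcup => // n; exact: gF.
    apply/seteqP; split=> w; rewrite /step /=.
      have [/set_mem[n _ Fw]|/negP nF] := boolP (w.1 \in _) => wt.
        by exists n => //=; rewrite mem_set.
      exists 0%N => //=; rewrite memNset// => Fw.
      by apply: nF; apply: mem_set; exists 0%N.
    move=> [n _ /=]; have [/set_mem Fw|_] := boolP (w.1 \in F n).
      by rewrite mem_set//; exists n.
    by case: ifP => // _ /le_trans; apply.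
  rewrite (_ : step _ a b = \bigcap_n step (F n) a b).
    by apply: suslin_bigcap => // n; exact: gF.
  apply/seteqP; split=> w; rewrite /step /=.
    have [/set_mem[n _ Fw]|/negP nF] := boolP (w.1 \in _) => wt k _ /=.
      by case: ifP => // _; apply: le_trans wt (ltW ab).
    by rewrite memNset// => Fw; apply: nF; apply: mem_set; exists k.
  move=> wF; have [/set_mem[n _ Fw]|/negP nF] := boolP (w.1 \in _).
    by have := wF n I; rewrite /= mem_set.
  have := wF 0%N I; rewrite /= memNset// => Fw.
  by apply: nF; apply: mem_set; exists 0%N.
have goodC B : good B -> good (~` B).
  by move=> gB a b a01 b01; rewrite stepC; exact: gB.
have sigma_good : sigma_algebra setT good.
  by split=> // B; rewrite setTD; exact: goodC.
have good_rect : <<s @rectangles _ (borel X) _ (borel Y) >> `<=` good.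
  apply: smallest_sub => // _ [C mC [D mD <-]] a b a01 b01.
  apply: suslin_base.
  exists (fun w => if (w.1 \in C) && (w.2 \in D) then a else b); split.
  - exact: rsimple_rect.
  - by move=> w; case: ifP.
  - by move=> w _; rewrite /step /= in_setX.
by apply: (smallest_sub sigma_good) mA => B /borel_rect; exact: good_rect.
Qed.

(** The hypograph of xi is a countable union of hypographs of multiples of
indicators over rational levels, up to the boundary t = xi, which does not
affect domination. *)
Theorem unit_duality (xi : Omega -> R) (c : R) :
  bmeas (xi : borel Omega -> R) -> (forall w, 0 <= xi w <= 1) ->
  (forall m, coupling mu nu m -> \int[m]_w xi w <= c) ->
  exists p, hedges mu nu (hypograph xi) c p.
Proof.
move=> bxi xi01 xic; apply: contrapT => nohedge.
(* attainment of the minimal cost leaves some room above c *)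
have [n nohedge_n] : exists n, ~ exists p, hedges mu nu (hypograph xi) (c + n.+1%:R^-1) p.
  apply: contrapT => /forallNP hedge_n; apply: nohedge.
  have inv_le k : (k.+2%:R^-1 : R) <= k.+1%:R^-1.
    by rewrite lef_pV2 ?posrE ?ltr0Sn// ler_nat.
  have [|k|k|p pP] := @hedges_limit _ _ _ _ _ mu nu (fun=> hypograph xi)
    (fun k => c + k.+1%:R^-1).
  - by move=> _.
  - by rewrite lerD2l.
  - by apply: contrapT; exact: hedge_n.
  exists p; have [up cov _] := pP 0%N; split=> //.
  apply/ler_addgt0Pr => e e0; pose k := Num.bound e^-1.
  have [_ _ cp] := pP k; apply: le_trans cp _; rewrite lerD2l.
  have ge0 : 0 <= e^-1 by rewrite invr_ge0 ltW.
  rewrite -[leRHS]invrK lef_pV2 ?posrE ?invr_gt0 ?ltr0Sn//.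
  by apply: le_trans (ltW (archi_boundP ge0)) _; rewrite ler_nat.
set c' := c + n.+1%:R^-1 in nohedge_n.
pose q k : R := if unpickle k is Some r then Num.max 0 (Num.min 1 (ratr (r : rat))) else 0.
have q01 k : 0 <= q k <= 1.
  rewrite /q; case: unpickle => [r|]; last by rewrite lexx ler01.
  by rewrite le_max lexx ge_max ler01 ge_min lexx.
pose Gamma := \bigcup_k step [set w | q k < xi w] (q k) 0.
have suslin_Gamma : suslin paving Gamma.
  apply: suslin_bigcup => // k; apply: borel_step; [|exact: q01|by rewrite lexx ler01].
  have := bxi.1 measurableT `]q k, +oo[%classic (measurable_itv _).
  by rewrite setTI preimage_itvoy.
have Gamma_xi w : strip w -> Gamma w -> w.2 <= xi w.1.
  move=> /andP[w0 _] [k _]; rewrite /step /=.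
  have [/set_mem/= qxi|_] := boolP (w.1 \in _); last by rewrite leNgt w0.
  by move=> /le_trans; apply; exact: ltW.
have xi_Gamma w : 0 < w.2 -> w.2 < xi w.1 -> Gamma w.
  move=> w0 wxi; have [r] := rat_in_itvoo wxi.
  rewrite in_itv /= => /andP[wr rxi].
  have qr : q (pickle r) = ratr r.
    rewrite /q pickleK min_r ?max_r// ?(ltW (lt_trans w0 wr))//.
    by apply: le_trans (ltW rxi) _; have /andP[] := xi01 w.1.
  by exists (pickle r) => //; rewrite /step /= mem_set /= qr// ltW.
(* a pair below xi at (x, y) fails at the height halfway up to xi (x, y) *)
have unhedged_Gamma : unhedged c' Gamma.
  move=> [p [up cov cp]]; apply: nohedge_n; exists p; split=> //.
  move=> [[x y] t] /= txi; apply: le_trans txi _.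
  have [_ _ p1 p2] := up; have /andP[p10 _] := p1 x; have /andP[p20 _] := p2 y.
  rewrite leNgt; apply/negP => pxi; pose z := (p.1 x + p.2 y + xi (x, y)) / 2.
  have z0 : 0 < z by rewrite /z; lra.
  have zxi : z < xi (x, y) by rewrite /z; lra.
  have := cov ((x, y), z); rewrite /= => /(_ _).
  have : (Gamma `&` strip) ((x, y), z).
    split; first exact: xi_Gamma.
    rewrite /strip /= z0 /=; apply: le_trans (ltW zxi) _.
    by have /andP[] := xi01 (x, y).
  by move=> Gz /(_ Gz); rewrite /z; lra.
have [B [PB CB Bdec BG]] := capacitability paving0 pavingT pavingU pavingI
  (@unhedged_up c') (@unhedged_cont c') suslin_Gamma unhedged_Gamma.
move: PB => /choice[f fP].
have fdec k w : f k.+1 w <= f k w.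
  have [_ f01 fB] := fP k; have [_ f01' fB'] := fP k.+1.
  have [f0|f0] := leP (f k.+1 w) 0; first by apply: le_trans f0 _; have /andP[] := f01 w.
  have sw : strip (w, f k.+1 w) by rewrite /strip /= f0; have /andP[] := f01' w.
  by apply/(fB _ sw)/Bdec/(fB' _ sw).
have [|||k|m cm fm] := unhedged_coupling mu_reg nu_reg borel_rect (f := f) (c := c').
- by move=> k; have [] := fP k.
- by move=> k; have [] := fP k.
- exact: fdec.
- move=> [p [up cov cp]]; apply: (CB k); exists p; split=> //.
  move=> w [Bw sw]; apply: cov; have [_ _ fB] := fP k.
  exact/(fB _ sw).
suff : c' <= \int[m]_w xi w.
  move=> /le_trans /(_ (xic _ cm)); rewrite /c' -lerBrDl subrr leNgt.
  by rewrite invr_gt0 ltr0Sn.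
apply: (@unit_decreasing_integral _ _ _ m f) => //.
- by move=> k; have [sf _ _] := fP k; case: (rsimple_bmeas sf).
- by move=> k w; have [_ /(_ w)] := fP k.
- move=> w a af; have [a0|a0] := leP a 0.
    by apply: le_trans a0 _; have /andP[] := xi01 w.
  have sa : strip (w, a).
    rewrite /strip /= a0 /=; apply: le_trans (af 0%N) _.
    by have [_ /(_ w)/andP[]] := fP 0%N.
  apply: (Gamma_xi (w, a) sa); apply: BG => k _.
  by have [_ _ fB] := fP k; apply/(fB _ sa); exact: af.
Qed.

End strong_duality.

(** * Duality for bounded Borel payoffs *)

Section kellerer.
Context (X Y : ptopologicalType) (R : realType).
Variables (mu : probability (borel X) R) (nu : probability (borel Y) R).
Hypotheses (mu_reg : compact_regular mu) (nu_reg : compact_regular nu).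
Let Omega : ptopologicalType := (X * Y)%type.
Hypothesis borel_rect : forall A : set Omega, open A ->
  <<s @rectangles _ (borel X) _ (borel Y) >> A.

(** The affine map of [- N, N] onto [0, 1] transports dominating pairs and
their costs. *)
Lemma kellerer_duality (xi : Omega -> R) (c : R) :
  bmeas (xi : borel Omega -> R) ->
  (forall m, coupling mu nu m -> \int[m]_w xi w <= c) ->
  exists h g, [/\ bmeas (h : borel X -> R), bmeas (g : borel Y -> R),
    forall w, xi w <= h w.1 + g w.2 & cost mu nu (h, g) <= c].
Proof.
move=> bxi xic; have [_ [M xiM]] := bxi.
pose N := M + 1; have M0 : 0 <= M by apply: le_trans (xiM point).
have N0 : 0 < N by rewrite ltr_wpDl.
pose a := (2 * N)^-1; have a0 : 0 < a by rewrite invr_gt0 mulr_gt0.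
have aN : a * (2 * N) = 1 by rewrite mulVf// gt_eqF// mulr_gt0.
have bxiN : bmeas (fun w : borel Omega => xi w + N).
  by apply: bmeasD => //; exact: bmeas_cst.
have [|w|m cm|p [up cov cp]] :=
  @unit_duality _ _ _ _ _ mu_reg nu_reg borel_rect (fun w => a * (xi w + N)) (a * (c + N)).
- exact: bmeasZ.
- have := xiM w; rewrite ler_norml => /andP[]; rewrite /N => x1 x2.
  apply/andP; split; first by apply: mulr_ge0; [exact: ltW|lra].
  by rewrite -[leRHS]aN ler_pM2l// /N; lra.
- rewrite bRintegralZ// ler_pM2l// (bRintegralD _ bxi (bmeas_cst _ N)) bRintegral_cst.
  by rewrite lerD2r xic.
have [b1 b2] := unit_pair_bmeas up.
exists (fun x => 2 * N * p.1 x - N), (fun y => 2 * N * p.2 y).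
have bZ1 := bmeasZ (2 * N) b1.
split; [by apply: bmeasB => //; exact: bmeas_cst|exact: bmeasZ| |].
- move=> w; rewrite -(ler_pM2l a0) addrAC mulrBr mulrDr !mulrA -(mulrA a 2) aN !mul1r.
  by have := cov (w, a * (xi w + N)) (lexx _); rewrite /= mulrDr; lra.
- rewrite /cost /= (bRintegralB _ bZ1 (bmeas_cst _ N)) !bRintegralZ// bRintegral_cst.
  have := cp; rewrite /cost -(ler_pM2l (_ : 0 < 2 * N)) ?mulr_gt0//.
  by rewrite [X in _ <= X]mulrA (mulrC (2 * N) a) aN mul1r mulrDr; lra.
Qed.

(** If there were no coupling, the duality would bound the cost of dominating 0
by - 1. *)
Lemma coupling_exists : exists m, coupling mu nu m.
Proof.
apply: contrapT => /forallNP nocpl.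
have [|h [g [bh bg hg hg1]]] := @kellerer_duality (cst 0) (- 1) (bmeas_cst _ 0).
  by move=> m /nocpl.
have := cost_ge0 mu nu bh bg (fun x y => hg (x, y)).
by move=> /le_trans/(_ hg1); rewrite ler0N1.
Qed.

(** From left to right, the inequality is integrated against a coupling.  From
right to left, a dominating pair is centered and its cost goes into the
constant. *)
Lemma superhedging_levelsE (xi : Omega -> R) (c : R) : Bb xi ->
  superhedging_levels mu nu xi c <->
  (forall m, coupling mu nu m -> \int[m]_w xi w <= c).
Proof.
move=> /BbP bxi; split.
  move=> [zeta [_ [[/BbP bzeta polar_zeta] [h [g [/BbP bh /BbP bg [h0 g0] ->]]] le_xi]]] m cm.
  have int_zeta : \int[m]_w zeta w = 0.
    have [mN mN0] := polar_zeta.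
    rewrite /Rintegral (@ae_eq_integral _ _ _ m setT (cst 0%E))//.
    - by rewrite integral0.
    - by apply/measurable_EFinP; case: bzeta.
    exists [set w | zeta w != 0]; split=> //; first exact/mN0/coupling_Qot.
    by move=> w /= nw; apply/eqP => zw; apply: nw => _; rewrite zw.
  have bhg := bmeas_oplus bh bg.
  have bcz : bmeas (fun w : borel Omega => c + zeta w).
    by apply: bmeasD => //; exact: bmeas_cst.
  apply: le_trans (le_bRintegral m bxi (bmeasD bcz bhg) le_xi) _.
  rewrite (bRintegralD _ bcz bhg) (coupling_oplus cm bh bg).
  rewrite (bRintegralD _ (bmeas_cst _ c) bzeta) bRintegral_cst int_zeta.
  by rewrite /Rintegral h0 g0 !addr0.
move=> /(kellerer_duality bxi)[h [g [bh bg xi_hg hgc]]].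
have bcst0 : @Bb R Omega (cst 0) by apply/BbP; exact: bmeas_cst.
pose a := \int[mu]_x h x; pose b := \int[nu]_y g y.
have bha : bmeas (fun x => h x - a) by apply: bmeasB => //; exact: bmeas_cst.
have bgb : bmeas (fun y => g y - b) by apply: bmeasB => //; exact: bmeas_cst.
exists (cst 0), (oplus (fun x => h x - a) (fun y => g y - b)); split.
- split=> //; rewrite (_ : [set _ | _] = set0); last first.
    by apply/seteqP; split=> w //=; rewrite eqxx.
  by split=> // m _; rewrite measure0.
- exists (fun x => h x - a), (fun y => g y - b); split=> //; [exact/BbP|exact/BbP|].
  split; rewrite -EFin_Rintegral//.
    by rewrite (bRintegralB _ bh (bmeas_cst _ a)) bRintegral_cst subrr.
  by rewrite (bRintegralB _ bg (bmeas_cst _ b)) bRintegral_cst subrr.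
- move=> w; apply: le_trans (xi_hg w) _; rewrite /oplus /= addr0.
  by move: hgc; rewrite /cost /= -/a -/b; lra.
Qed.

Lemma dual_levelsE (xi : Omega -> R) : Bb xi ->
  [set c : R | exists2 k, set_add (Hot_infty_hat mu nu) Bb_nonpos k &
    (fun z => c + k z) = xi] = superhedging_levels mu nu xi.
Proof.
move=> bxi; apply/seteqP; split=> c.
  move=> [_ [_ [zeta Zzeta [f Hf <-]] [b [bb b0] <-]] <-].
  exists zeta, f; split=> // w /=.
  by have := b0 w; lra.
move=> [zeta [f [Zzeta Hf le_xi]]].
pose b w := xi w - (c + zeta w + f w).
exists ((zeta \+ f) \+ b); last by apply/funext => w; rewrite /b /=; lra.
exists (zeta \+ f); first by exists zeta => //; exists f.
exists b => //; split; last by move=> w; rewrite /b subr_le0.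
apply/BbP; apply: bmeasB; first exact/BbP.
apply: bmeasD; first apply: bmeasD; [exact: bmeas_cst|by case: Zzeta => /BbP|].
by case: Hf => [h [g [/BbP bh /BbP bg _ ->]]]; exact: bmeas_oplus.
Qed.

Theorem kellerer (xi : Omega -> R) (Bxi : Bb xi) :
  primal_value mu nu xi =
    dual_value xi (set_add (Hot_infty_hat mu nu) Bb_nonpos) /\
  exists c : R, is_minimum (superhedging_levels mu nu xi) c /\
    dual_value xi (set_add (Hot_infty_hat mu nu) Bb_nonpos) = c%:E.
Proof.
have bxi := (BbP xi).1 Bxi.
pose S := [set \int[m]_w xi w | m in coupling mu nu].
have S0 : S !=set0 by have [m cm] := coupling_exists; exists (\int[m]_w xi w), m.
have Sub : has_ubound S.
  have [_ [M xiM]] := bxi; exists M => _ [m _ <-].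
  rewrite -(bRintegral_cst m M); apply: le_bRintegral => //; first exact: bmeas_cst.
  by move=> w; apply: le_trans (ler_norm _) (xiM w).
have primalE : primal_value mu nu xi = (sup S)%:E.
  rewrite -ereal_sup_EFin//; congr ereal_sup; apply/seteqP; split=> r [].
    move=> m /Qot_coupling cm <-; exists (\int[m]_w xi w); first by exists m.
    exact: EFin_Rintegral.
  move=> _ [m cm <-] <-; exists m; first exact: coupling_Qot.
  by rewrite EFin_Rintegral.
have min_c : is_minimum (superhedging_levels mu nu xi) (sup S).
  split.
    by apply/(superhedging_levelsE _ Bxi) => m cm; apply: ub_le_sup => //; exists m.
  move=> c /(superhedging_levelsE _ Bxi) xic; apply: ge_sup => // _ [m cm <-].
  exact: xic.
have dualE : dual_value xi (set_add (Hot_infty_hat mu nu) Bb_nonpos) = (sup S)%:E.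
  rewrite /dual_value dual_levelsE//; apply/eqP; rewrite eq_le; apply/andP; split.
    by apply: ereal_inf_lbound; exists (sup S) => //; case: min_c.
  by apply: le_ereal_inf_tmp => _ [c Lc <-]; rewrite lee_fin; apply: min_c.2.
split; first by rewrite primalE dualE.
by exists (sup S).
Qed.

End kellerer.

Theorem proposition5p5 (R : realType) (d : nat) (X Y : set 'rV[R]_d)
    (X0 : X !=set0) (Y0 : Y !=set0) (cX : closed X) (cY : closed Y)
    (mu : probability (borel (pointed_sub X0)) R)
    (nu : probability (borel (pointed_sub Y0)) R)
    (xi : (pointed_sub X0 * pointed_sub Y0)%type -> R) (Bxi : Bb xi) :
  primal_value mu nu xi =
    dual_value xi (set_add (Hot_infty_hat mu nu) Bb_nonpos) /\
  exists c : R, is_minimum (superhedging_levels mu nu xi) c /\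
    dual_value xi (set_add (Hot_infty_hat mu nu) Bb_nonpos) = c%:E.
Proof.
apply: kellerer => //.
- exact/sigma_compact_regular/sigma_compact_opens_sub.
- exact/sigma_compact_regular/sigma_compact_opens_sub.
- by move=> A; apply: open_sigma_rectangles; exact: countable_base_sub.
Qed.
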